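(* Let $K=\sum_{P} q^{\text{area of }P}$, where the sum runs over all level two cheesy polyominoes $P$ (on the hexagonal tiling, counted up to translation). Then, as a formal power series in $q$, $$K=\frac{q\cdot(1-6q+11q^{2}-6q^{3}-q^{4}-3q^{6}+5q^{7}+4q^{8}-3q^{9}-3q^{10})}{1-9q+27q^{2}-31q^{3}+8q^{4}+4q^{5}-2q^{6}+16q^{7}-5q^{8}-16q^{9}-2q^{10}+5q^{11}}.$$
   Context: Consider the regular hexagonal tiling of the Euclidean plane, oriented so that every hexagonal tile has two horizontal edges; tiles are called cells. A (hexagonal-celled) polyomino is a union of finitely many (at least one) cells whose interior is connected (for unions of hexagonal cells, this is equivalent to the union being connected). Two polyominoes are considered equal if and only if one is the image of the other under a translation. The area of a polyomino is its number of cells. The cells of a polyomino $P$ are partitioned according to their horizontal projection (cells with the same projection onto the horizontal axis lie in the same block); each block is a column of $P$. Cells of the tiling with the same horizontal projection are stacked vertically, consecutive ones sharing a horizontal edge. A column need not be a connected set; its connected components are its maximal runs of vertically consecutive cells. If a column has two connected components, the gap (hole) between them is the set of cells of the tiling lying in that vertical stack strictly between the two components. Columns are ordered from left to right; the first column is the leftmost one, and two columns are adjacent if they are consecutive in this order. A polyomino $P$ is rightward-semi-directed if the first (leftmost) column of $P$ has no gap (i.e. is connected) and, in every pair of adjacent columns of $P$, every connected component of the right column has at least one edge in common with the left column. For an integer $m\ge 1$, a polyomino $P$ is a level $m$ cheesy polyomino if: (i) $P$ is rightward-semi-directed; (ii) every column of $P$ has at most two connected components; (iii) if a column of $P$ has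 two connected components, then the gap between the components consists of at most $m$ cells. *)

(* Defs.v *)
From mathcomp Require Import all_boot all_order all_algebra finmap.
From mathcomp Require Import boolp classical_sets cardinality.
Set Implicit Arguments.
Unset Strict Implicit.
Unset Printing Implicit Defensive.

Import GRing.Theory Num.Theory.
Local Open Scope fset_scope.
Local Open Scope ring_scope.

(* The cell (i, j) of the hexagonal tiling (unit sides, every tile having two
   horizontal edges) is the hexagon centred at
   (3/2 * i, sqrt 3 * (j + i/2)): the abscissa i determines the horizontal
   projection and j increases by one for each step up.                        *)
Definition cell : Type := (int * int)%type.

Definition share_edge (c d : cell) : bool :=
  (d.1 - c.1, d.2 - c.2) \in
    [:: (0, 1); (0, -1); (1, 0); (1, -1); (-1, 0); (-1, 1)].

(* The edge-sharing graph on a finite set A of cells; its connectedness is the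
   connectedness of the interior of the union of A, since every vertex of the
   tiling lies on exactly three cells, which pairwise share an edge.           *)
Definition adj_in (A : {fset cell}) : rel A :=
  fun x y => share_edge (val x) (val y).

Definition connected_cells (A : {fset cell}) : bool :=
  [forall x : A, forall y : A, connect (@adj_in A) x y].

Definition component_of (A : {fset cell}) (x : A) : {fset cell} :=
  [fset val y | y : A & connect (@adj_in A) x y].

Definition components (A : {fset cell}) : {fset {fset cell}} :=
  [fset component_of x | x : A].

Definition polyomino (P : {fset cell}) : bool :=
  (P != fset0) && connected_cells P.

Definition area (P : {fset cell}) : nat := #|` P|.

Definition column (P : {fset cell}) (i : int) : {fset cell} :=
  [fset c in P | c.1 == i].

Definition column_indices (P : {fset cell}) : {fset int} :=
  [fset c.1 | c in P].

Definition first_column (P : {fset cell}) (i : int) : Prop :=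
  i \in column_indices P /\ forall k, k \in column_indices P -> i <= k.

Definition adjacent_columns (P : {fset cell}) (i j : int) : Prop :=
  [/\ i \in column_indices P, j \in column_indices P, i < j &
      forall k, k \in column_indices P -> ~~ (i < k < j)].

Definition rightward_semi_directed (P : {fset cell}) : Prop :=
  (forall i, first_column P i -> connected_cells (column P i)) /\
  (forall i j, adjacent_columns P i j ->
     forall C, C \in components (column P j) ->
       exists c d, [/\ c \in C, d \in column P i & share_edge c d]).

Definition in_gap (i : int) (C D : {fset cell}) (g : cell) : Prop :=
  [/\ g.1 = i, forall c, c \in C -> c.2 < g.2 &
      forall d, d \in D -> g.2 < d.2].

(* In the last condition C is the lower component and D the upper one. *)
Definition cheesy (m : nat) (P : {fset cell}) : Prop :=
  [/\ polyomino P,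
      rightward_semi_directed P,
      forall i, i \in column_indices P -> (#|` components (column P i)| <= 2)%N &
      forall i C D, i \in column_indices P ->
        C \in components (column P i) -> D \in components (column P i) ->
        (forall c d, c \in C -> d \in D -> c.2 < d.2) ->
        exists2 G : {fset cell},
          (forall g, g \in G <-> in_gap i C D g) & (#|` G| <= m)%N].

(* A translation of the plane mapping some union of cells to a union of cells
   preserves the tiling, hence acts on the indices of the cells by a vector of
   integers.                                                                   *)
Definition translate (v : int * int) (P : {fset cell}) : {fset cell} :=
  [fset (c.1 + v.1, c.2 + v.2) | c in P].

Definition translation_class (P : {fset cell}) : set {fset cell} :=
  [set translate v P | v in [set: int * int]]%classic.

Definition cheesy_classes (m n : nat) : set (set {fset cell}) :=
  [set translation_class P | P in [set P | cheesy m P /\ area P = n]]%classic.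

(* Formal power series in q over the integers, as coefficient sequences. *)
Definition fps : Type := nat -> int.

Definition fps_of_poly (p : {poly int}) : fps := fun n => p`_n.

Definition fps_mul (f g : fps) : fps :=
  fun n => \sum_(k < n.+1) f k * g (n - k)%N.

(* fset_set returns the empty set on infinite sets, so this is the intended
   count only when the sets cheesy_classes m n are finite.                     *)
Definition cheesy_gf (m : nat) : fps :=
  fun n => (#|` fset_set (cheesy_classes m n)|)%:Z.

Definition K_num : {poly int} :=
  'X * (1 - 6 * 'X + 11 * 'X^2 - 6 * 'X^3 - 'X^4 - 3 * 'X^6 + 5 * 'X^7
        + 4 * 'X^8 - 3 * 'X^9 - 3 * 'X^10).

Definition K_den : {poly int} :=
  1 - 9 * 'X + 27 * 'X^2 - 31 * 'X^3 + 8 * 'X^4 + 4 * 'X^5 - 2 * 'X^6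
  + 16 * 'X^7 - 5 * 'X^8 - 16 * 'X^9 - 2 * 'X^10 + 5 * 'X^11.

(* Main.v *)
Require Import Defs.
From HB Require Import structures.
From mathcomp Require Import all_boot all_order all_algebra finmap ring zify.
From mathcomp Require Import boolp classical_sets functions cardinality.
Set Implicit Arguments.
Unset Strict Implicit.
Unset Printing Implicit Defensive.
Import Order.TTheory GRing.Theory Num.Theory.
Local Open Scope fset_scope.
Local Open Scope ring_scope.

(* A level m cheesy polyomino is determined by its sequence of columns.  A hole
   has at most m cells, each component of a column must meet the neighbourhood
   of the previous column, and connectedness is then automatic; so the classes
   correspond to words over column shapes, with a relative offset at each step.
   For m = 2 the number of admissible offsets from a column with runs a, b and
   gap g to the next one is affine in a + b, up to corrections for runs of
   length one (a single cell can sit in the middle of a gap of size two without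
   touching anything).  Hence the generating function of the continuations of a
   word is, as a function of its last column, a combination of seven series,
   and summing over the next column gives a linear system for these series,
   which is solved by Cramer's rule. *)

(** * Connectivity inside a finite set of cells *)

(** Shapes are infinitely many, so the transfer matrix [transitions s t] is infinite; the proof
    works because it has finite rank. For [s] of a given gap size it is a combination of the
    constant, the total length of [s] and indicators of runs of length one, with coefficients
    depending on [t] alone. The unknown series are the sums of continuations against these
    coefficients, with [serQlow] and [serQhigh] merged since the equations only see their sum. The
    reason for the small rank is that a run of n cells meets the previous column along a block of n
    + 1 consecutive cells. This block has at least two cells, so a gap of size one never contains
    it, and a gap of size two contains it only when n = 1. A further correction comes from a single
    cell followed by a column with gap two: the linear count would be -1 there instead of 0. The
    wanted series is itself one of the unknowns, so no separate summation over first columns is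
    needed. *)

(* Lying in the same connected component, phrased without paths and without
   the dependent type of the elements of A: d belongs to every set of cells that
   contains c and is closed under adjacency in A. *)
Definition reach (A : {fset cell}) (c d : cell) : Prop :=
  forall S : cell -> Prop, S c ->
  (forall x y, x \in A -> y \in A -> share_edge x y -> S x -> S y) -> S d.

Lemma connect_reach (A : {fset cell}) (x y : A) :
  connect (@adj_in A) x y <-> reach A (val x) (val y).
Proof.
split=> [/connectP[p + ->]|].
  elim: p x => [|z p IH] x /= => [_ S Sx //|/andP[xz zp] S Sx Sstep].
  by apply: (IH z zp) => //; apply: Sstep xz Sx; apply: valP.
move=> /(_ (fun d => exists2 z : A, d = val z & connect (@adj_in A) x z)).
case=> [|c d cA dA cd [z cz xz]|z /val_inj->//]; first by exists x.
exists [` dA] => //; apply: connect_trans xz (connect1 _).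
by rewrite /adj_in /= -cz.
Qed.

Lemma connected_cellsP (A : {fset cell}) :
  connected_cells A <-> forall c d : cell, c \in A -> d \in A -> reach A c d.
Proof.
split=> [/forallP H c d cA dA|H].
  have /forallP/(_ [` dA]) := H [` cA].
  by move/connect_reach.
apply/forallP => x; apply/forallP => y; apply/connect_reach.
by apply: H; apply: valP.
Qed.

Lemma in_component_of (A : {fset cell}) (x : A) d :
  d \in component_of x <-> d \in A /\ reach A (val x) d.
Proof.
split=> [/imfsetP[y /= xy ->]|[dA xd]].
  by split; [apply: valP | apply/connect_reach].
by apply/imfsetP; exists [` dA] => //=; apply/connect_reach.
Qed.

Lemma in_components (A C : {fset cell}) : C \in components A <->
  exists2 c : cell, c \in A & forall d : cell, d \in C <-> d \in A /\
    reach A c d.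
Proof.
split=> [/imfsetP[x _ ->]|[c cA HC]].
  by exists (val x); [apply: valP | exact: in_component_of].
apply/imfsetP; exists [` cA] => //=; apply/fsetP => d.
by apply/idP/idP => [/HC H|/(in_component_of [` cA]) H];
  [apply/(in_component_of [` cA]) | apply/HC].
Qed.

Lemma reach_trans A c d e : reach A c d -> reach A d e -> reach A c e.
Proof. by move=> cd de S Sc Sstep; apply: (de S) => //; apply: cd. Qed.

Lemma reach_step (A : {fset cell}) c d :
  c \in A -> d \in A -> share_edge c d -> reach A c d.
Proof. by move=> cA dA cd S Sc Sstep; apply: Sstep cd Sc. Qed.

Lemma share_edge_sym c d : share_edge c d = share_edge d c.
Proof.
case: c d => [a b] [e f]; rewrite /share_edge /= !inE !xpair_eqE /=.
lia.
Qed.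

Lemma reach_sym A c d : reach A c d -> reach A d c.
Proof.
move=> cd; apply: (cd (fun x => reach A x c)) => // x y xA yA xy xc.
by apply: reach_trans xc; apply: reach_step => //; rewrite share_edge_sym.
Qed.

Lemma reach_sub (A B : {fset cell}) c d :
  A `<=` B -> reach A c d -> reach B c d.
Proof.
move=> /fsubsetP AB cd S Sc Sstep; apply: cd => // x y xA yA.
by apply: Sstep; apply: AB.
Qed.

(** * Columns *)

(* (c, h, d) is a run of c cells, a gap of h cells and a run of d cells, from
   bottom to top; a column with one component is (c, 0, 0).  A column is a shape
   with the height of its lowest cell. *)
Definition shape : Type := (nat * nat * nat)%type.

Definition col : Type := (int * shape)%type.

Definition shape_size (s : shape) : nat := let: (c, _, d) := s in (c + d)%N.

Definition in_col (x : col) (z : int) : bool :=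
  let: (u, (c, h, d)) := x in
  (u <= z < u + c%:Z) || (u + (c + h)%:Z <= z < u + (c + h + d)%:Z).

(** The last clause makes the encoding canonical: otherwise [(c, 0, d)] would describe the same
    cells as [(c + d, 0, 0)], and [(c, h, 0)] the same as [(c, 0, 0)]. *)
Definition valid_shape (m : nat) (s : shape) : bool :=
  let: (c, h, d) := s in [&& 0 < c, h <= m & (h == 0) == (d == 0)]%N.

Definition is_column (A : {fset cell}) (i : int) (x : col) : Prop :=
  forall c : cell, c \in A <-> c.1 = i /\ in_col x c.2.

Lemma share_edge_vertical i z z' :
  share_edge (i, z) (i, z') = (z' == z + 1) || (z == z' + 1).
Proof. rewrite /share_edge /= !inE !xpair_eqE /=; lia. Qed.

Lemma reach_run (A : {fset cell}) i u (n : nat) :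
  (forall z, u <= z < u + n%:Z -> (i, z) \in A) ->
  forall z z', u <= z < u + n%:Z -> u <= z' < u + n%:Z ->
    reach A (i, z) (i, z').
Proof.
move=> HA.
have R k : (k < n)%N -> reach A (i, u) (i, u + k%:Z).
  elim: k => [|k IH] kn; first by rewrite addr0.
  apply: reach_trans (IH _) _; first by lia.
  apply: reach_step; rewrite ?share_edge_vertical; try apply: HA; lia.
have {}R z : u <= z < u + n%:Z -> reach A (i, u) (i, z).
  move=> Hz; have -> : z = u + `|z - u|%N%:Z by lia.
  by apply: R; lia.
by move=> z z' /R/reach_sym uz /R uz'; apply: reach_trans uz'.
Qed.



(** Inside one stack an edge changes the height by exactly one, so no path can pass a missing
    cell. *)
Lemma reach_barrier (A : {fset cell}) i b c d :
  (forall e : cell, e \in A -> e.1 = i) -> (i, b) \notin A ->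
  reach A c d -> c.2 < b -> d.2 < b.
Proof.
move=> Ai bA + cb; move=> /(_ (fun e => e.2 < b)); apply=> //.
move=> [x1 x2] [y1 y2] xA yA + /= xb.
have := Ai _ xA; have := Ai _ yA => /= y1i x1i; rewrite y1i x1i in xA yA *.
rewrite share_edge_vertical => xy.
have yb : y2 != b by apply: contraNneq bA => <-.
lia.
Qed.

Section ColumnComponents.

Variables (A : {fset cell}) (i u : int) (c h d : nat).
Hypotheses (colA : is_column A i (u, (c, h, d))).
Hypotheses (c_gt0 : (0 < c)%N) (hd : (h == 0%N) == (d == 0%N)).

Lemma column_reachP (x y : cell) : x \in A -> y \in A ->
  reach A x y <-> (x.2 < u + c%:Z) = (y.2 < u + c%:Z).
Proof.
move=> xA yA.
have [x1 x2] := (colA x).1 xA; have [y1 y2] := (colA y).1 yA.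
have Ai e : e \in A -> e.1 = i by case/colA.
(* The cell just above the lower run is empty even if [h = 0], because then [d = 0]. *)
have bA : (i, u + c%:Z) \notin A.
  by apply/negP => /colA[_ /=]; lia.
split=> [xy|].
  apply/idP/idP; first exact: (reach_barrier Ai bA xy).
  exact: (reach_barrier Ai bA (reach_sym xy)).
have Ai1 z : u <= z < u + c%:Z -> (i, z) \in A.
  by move=> Hz; apply/colA; split=> //=; rewrite Hz.
have Ai2 z : u + (c + h)%:Z <= z < u + (c + h)%:Z + d%:Z -> (i, z) \in A.
  by move=> Hz; apply/colA; split=> //=; lia.
move: x y x1 y1 x2 y2 {xA yA} => [x1 x2] [y1 y2] /= -> -> Hx Hy E.
by case: (ltP x2 (u + c%:Z)) E => H E;
  [apply: (reach_run Ai1) | apply: (reach_run Ai2)]; lia.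
Qed.

Lemma column_connected : connected_cells A <-> d = 0%N.
Proof.
split=> [/connected_cellsP H|d0].
  have [//|dn0] := eqVneq d 0%N.
  have bA : (i, u) \in A by apply/colA; split=> //=; lia.
  have tA : (i, u + (c + h)%:Z) \in A by apply/colA; split=> //=; lia.
  by move: (H _ _ bA tA) => /(column_reachP bA tA) /=; lia.
apply/connected_cellsP => x y xA yA; apply/column_reachP => //.
have [_ /=] := (colA x).1 xA; have [_ /=] := (colA y).1 yA; lia.
Qed.

Let low := [fset e : cell in A | e.2 < u + c%:Z].
Let high := [fset e : cell in A | ~~ (e.2 < u + c%:Z)].

Lemma in_low (e : cell) : e \in low <-> e.1 = i /\ u <= e.2 < u + c%:Z.
Proof.
rewrite !inE /=; split=> [/andP[/colA[-> /=]]|[e1 e2]].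
  by split=> //; lia.
by apply/andP; split; [apply/colA; split=> //=|]; lia.
Qed.

Lemma in_high (e : cell) : e \in high <->
  e.1 = i /\ u + (c + h)%:Z <= e.2 < u + (c + h + d)%:Z.
Proof.
rewrite !inE /=; split=> [/andP[/colA[-> /=]]|[e1 e2]].
  by split=> //; lia.
by apply/andP; split; [apply/colA; split=> //=|]; lia.
Qed.

Lemma column_components C :
  C \in components A <-> C = low \/ d <> 0%N /\ C = high.
Proof.
have lA e : e \in low -> e \in A by rewrite !inE /= => /andP[].
have hA e : e \in high -> e \in A by rewrite !inE /= => /andP[].
split=> [/in_components[e eA HC]|].
  have Ce f : f \in C <->
     f \in A /\ (e.2 < u + c%:Z) = (f.2 < u + c%:Z).
    split=> [/HC[fA /(column_reachP eA fA)]//|[fA] R].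
    by apply/HC; split=> //; apply/column_reachP.
  case: (ltP e.2 (u + c%:Z)) Ce => He Ce; [left | right; split].
  - apply/fsetP => f; rewrite !inE /=; apply/idP/andP => [/Ce[fA <-]//|[fA fc]].
    by apply/Ce.
  - by have [_ /=] := (colA e).1 eA; lia.
  apply/fsetP => f; rewrite !inE /=; apply/idP/andP => [/Ce[fA <-]//|[fA fc]].
  by apply/Ce; split=> //; apply/esym/negbTE.
case=> [->|[dn0 ->]]; apply/in_components.
  have bA : (i, u) \in A by apply/lA/in_low; split=> //=; lia.
  exists (i, u) => // e; rewrite !inE /=.
  split=> [/andP[eA He]|[eA /(column_reachP bA eA) /=]].
    by split=> //; apply/column_reachP => //=; lia.
  by rewrite eA; lia.
have bA : (i, u + (c + h)%:Z) \in A by apply/hA/in_high; split=> //=; lia.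
exists (i, u + (c + h)%:Z) => // e; rewrite !inE /=.
split=> [/andP[eA He]|[eA /(column_reachP bA eA) /=]].
  by split=> //; apply/column_reachP => //=; lia.
by rewrite eA; lia.
Qed.

Lemma column_card_components : (#|` components A| <= 2)%N.
Proof.
have : components A `<=` [fset low; high].
  by apply/fsubsetP => C /column_components[->|[_ ->]]; rewrite !inE eqxx ?orbT.
move/fsubset_leq_card/leq_trans; apply.
by rewrite cardfs2; case: eqP.
Qed.

(** Among ordered pairs of components only ([low], [high]) can satisfy the height hypothesis, and
    its gap has [h] cells. With one component there is no such pair, and [h = 0]. *)
Lemma column_gap (m : nat) :
  (forall C D, C \in components A -> D \in components A ->
     (forall e f : cell, e \in C -> f \in D -> e.2 < f.2) ->
     exists2 G : {fset cell},
       (forall g, g \in G <-> in_gap i C D g) & (#|` G| <= m)%N) <->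
  (h <= m)%N.
Proof.
pose gap := [fset (i, u + k%:Z) | k in iota c h].
have gapP (g : cell) : g \in gap <-> g.1 = i /\
  u + c%:Z <= g.2 < u + (c + h)%:Z.
  split=> [/imfsetP[k /=]|[g1 g2]].
    by rewrite mem_iota => Hk -> /=; split=> //; lia.
  apply/imfsetP; exists (`|g.2 - u|%N); rewrite /= ?mem_iota; first by lia.
  by case: g g1 g2 => a b /= -> Hb; congr pair; lia.
have gap_card : #|` gap| = h.
  rewrite card_imfset /=; last by move=> k k' [] /addrI[].
  by rewrite undup_id ?iota_uniq ?size_iota.
split=> [H|hm C D].
  have [->//|hn0] := eqVneq h 0%N.
  have [] := H low high.
  - by apply/column_components; left.
  - by apply/column_components; right; split=> //; move: hd; lia.
  - by move=> e f /in_low[_ He] /in_high[_ Hf]; lia.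
  move=> G HG; apply: leq_trans; rewrite -[leqLHS]gap_card;
    apply: fsubset_leq_card.
  apply/fsubsetP => -[g1 g2] /gapP[/= g1i Hg]; apply/HG; split=> //=.
    by move=> [e1 e2] /in_low[_ /= He]; lia.
  by move=> [e1 e2] /in_high[_ /= He]; lia.
have lmem : (i, u) \in low by apply/in_low; split=> //=; lia.
have lmem' : (i, u + c%:Z - 1) \in low by apply/in_low; split=> //=; lia.
have hmem : d <> 0%N -> (i, u + (c + h)%:Z) \in high.
  by move=> dn0; apply/in_high; split=> //=; lia.
move=> /column_components[->|[dn0 ->]] /column_components[->|[dn0' ->]] CD.
- by have := CD _ _ lmem lmem; rewrite ltxx.
- exists gap; last by rewrite gap_card.
  move=> [g1 g2]; split=> [/gapP[/= g1i Hg]|[g1i gC gD]].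
    by split=> // -[e1 e2];
      [move=> /in_low[_ /= He] | move=> /in_high[_ /= He]]; lia.
  apply/gapP; split=> //.
  by have := gC _ lmem'; have := gD _ (hmem dn0') => /=; lia.
- by have /= := CD _ _ (hmem dn0) lmem; lia.
- by have := CD _ _ (hmem dn0) (hmem dn0); rewrite ltxx.
Qed.

End ColumnComponents.

(** * Reading off the runs of a column from its cells *)

Lemma int_min (P : pred int) (B : nat) z0 :
  (forall z, P z -> (`|z| <= B)%N) -> P z0 ->
  exists2 u, P u & forall z, P z -> u <= z.
Proof.
move=> PB Pz0.
have exP : exists k : nat, P (k%:Z - B%:Z).
  exists (absz (z0 + B%:Z)); have := PB _ Pz0 => H.
  by have -> : (absz (z0 + B%:Z))%:Z - B%:Z = z0 by lia.
case: (ex_minnP exP) => k Pk kmin; exists (k%:Z - B%:Z) => // z Pz.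
have Hz := PB _ Pz.
have := kmin (absz (z + B%:Z));
  have -> : (absz (z + B%:Z))%:Z - B%:Z = z by lia.
by move=> /(_ Pz); lia.
Qed.

Lemma int_run (P : pred int) (B : nat) u :
  (forall z, P z -> (`|z| <= B)%N) -> P u ->
  exists2 n : nat, (0 < n)%N &
    (forall z, u <= z < u + n%:Z -> P z) /\ ~~ P (u + n%:Z).
Proof.
move=> PB Pu.
have exP : exists k : nat, ~~ P (u + k%:Z).
  exists (absz u + B.+1)%N; apply/negP => /PB; lia.
case: (ex_minnP exP) => k Pk kmin; exists k.
  by case: k Pk {kmin} => //; rewrite addr0 Pu.
split=> // z Hz; apply: contraT => nPz.
have := kmin (absz (z - u)); have -> : u + (absz (z - u))%:Z = z by lia.
by move=> /(_ nPz); lia.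
Qed.

Lemma is_column_exists (A : {fset cell}) i :
  A != fset0 -> (forall c : cell, c \in A -> c.1 = i) ->
  (#|` components A| <= 2)%N ->
  exists u c h d, [/\ is_column A i (u, (c, h, d)), (0 < c)%N &
    (h == 0%N) == (d == 0%N)].
Proof.
move=> /fset0Pn[[j z0] z0A] Ai A2.
have := Ai _ z0A => /= ji; rewrite {}ji in z0A.
pose P (z : int) := (i, z) \in A.
pose B := \max_(c <- A) absz c.2.
have PB z : P z -> (`|z| <= B)%N.
  move=> Pz; exact: (@leq_bigmax_seq _ _ xpredT (fun c : cell =>
    absz c.2) (i, z)).
have [u Pu umin] := int_min PB z0A.
have [c c_gt0 [Pc nPc]] := int_run PB Pu.
have [[z /andP[Pz uz]]|noz] :=
  pselect (exists z : int, P z && (u + c%:Z <= z)); last first.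
  exists u, c, 0%N, 0%N; split=> // -[e1 e2] /=.
  split=> [eA|[-> He]]; last by apply: Pc; lia.
  have /= e1i := Ai _ eA; rewrite e1i in eA *; split=> //.
  have := umin _ eA; have : ~~ (u + c%:Z <= e2); last by lia.
  by apply/negP => He; apply: noz; exists e2; apply/andP.
pose P' (z : int) := P z && (u + c%:Z <= z).
have P'B z' : P' z' -> (`|z'| <= B)%N by case/andP => /PB.
have [|v /andP[Pv uv] vmin] := @int_min P' B z P'B; first by apply/andP.
have [d d_gt0 [Pd nPd]] := int_run PB Pv.
have v_neq : v != u + c%:Z by apply: contraNneq nPc => <-.
have [[y /andP[Py vy]]|noy] :=
  pselect (exists y : int, P y && (v + d%:Z <= y)); last first.
  exists u, c, (absz (v - u - c%:Z)%R), d; split=> //; last by lia.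
  move=> -[e1 e2] /=; split=> [eA|[-> /orP[]He]]; last 2 first.
  - by apply: Pc; lia.
  - by apply: Pd; lia.
  have /= e1i := Ai _ eA; rewrite e1i in eA *; split=> //.
  have := umin _ eA; have : ~~ (v + d%:Z <= e2).
    by apply/negP => He; apply: noy; exists e2; apply/andP.
  have : u + c%:Z <= e2 -> v <= e2 by move=> He; apply: vmin; apply/andP.
  by lia.
(* A cell [y] above the second run would give a third component: the missing cells at heights
   [u + c] and [v + d] separate [u], [v] and [y] pairwise. *)
pose K (w : int) := [fset e : cell in A | `[<reach A (i, w) e>]].
have Kcomp w : P w -> K w \in components A.
  move=> Pw; apply/in_components; exists (i, w) => // e; rewrite !inE /=.
  by split=> [/andP[eA /asboolP]//|[eA we]]; apply/andP; split=> //;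
    apply/asboolP.
have Kneq w w' b : P w -> P w' -> ~~ P b -> w < b -> b <= w' -> K w != K w'.
  move=> Pw Pw' Pb wb bw'; apply: contraTneq bw' => KK.
  have : (i, w') \in K w.
    by rewrite KK !inE /=; apply/andP; split=> //; apply/asboolP.
  rewrite !inE /= => /andP[_ /asboolP ww'].
  by rewrite -ltNge; exact: (reach_barrier Ai Pb ww').
have : (size [:: K u; K v; K y] <= 2)%N; last by [].
apply: leq_trans A2; apply: uniq_leq_size => [|C].
  rewrite /= !inE negb_or andbT; apply/andP; split;
    last by apply: (Kneq _ _ (v + d%:Z)) => //; lia.
  apply/andP; split; [apply: (Kneq _ _ (u + c%:Z)) | apply: (Kneq _ _ (u +
    c%:Z))] => //; lia.
by rewrite !inE => /or3P[] /eqP->; apply: Kcomp.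
Qed.

(** * The set of cells of a word of columns *)

Definition col_seq (x : col) : seq int :=
  let: (u, (c, h, d)) := x in
  [seq u + k%:Z | k <- iota 0 c ++ iota (c + h) d].

Lemma mem_col_seq x z : (z \in col_seq x) = in_col x z.
Proof.
case: x => u [[c h] d] /=; apply/mapP/idP => [[k + ->]|Hz].
  by rewrite mem_cat !mem_iota; lia.
exists (absz (z - u)%R); last by lia.
by rewrite mem_cat !mem_iota; lia.
Qed.

Lemma col_seq_uniq x : uniq (col_seq x).
Proof.
case: x => u [[c h] d] /=; rewrite map_inj_uniq => [|k k' /addrI[]//].
rewrite cat_uniq !iota_uniq andbT /=; apply/hasPn => k.
by rewrite !mem_iota; lia.
Qed.

Lemma size_col_seq x : size (col_seq x) = shape_size x.2.
Proof. by case: x => u [[c h] d]; rewrite size_map size_cat !size_iota. Qed.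

Fixpoint cells (i : int) (w : seq col) : {fset cell} :=
  if w is x :: w' then
    [fset (i, z) | z in col_seq x] `|` cells (i + 1) w'
  else fset0.

Definition col0 : col := (0, (1, 0, 0)%N).

Lemma in_cells i w (c : cell) : c \in cells i w <->
  exists2 k, (k < size w)%N & c.1 = i + k%:Z /\ in_col (nth col0 w k) c.2.
Proof.
elim: w i => [|x w IH] i /=; first by rewrite inE; split=> // -[].
rewrite inE; split=> [/orP[/imfsetP[z /= zx ->]|/IH[k kw [ck xk]]]|].
- by exists 0%N; rewrite //= addr0 -mem_col_seq.
- by exists k.+1; rewrite //=; split=> //; lia.
case=> -[_ [c1 cx]|k kw [c1 cx]]; apply/orP; [left|right].
  apply/imfsetP; exists c.2; rewrite /= ?mem_col_seq //.
  by rewrite [LHS]surjective_pairing c1 addr0.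
by apply/IH; exists k => //; split=> //; lia.
Qed.

Lemma area_cells i w : area (cells i w) = (\sum_(x <- w) shape_size x.2)%N.
Proof.
elim: w i => [|x w IH] i /=; first by rewrite big_nil /area cardfs0.
rewrite big_cons -(IH (i + 1)) /area cardfsU.
have -> : [fset (i, z) | z in col_seq x] `&` cells (i + 1) w = fset0.
  apply/eqP; rewrite -fsubset0; apply/fsubsetP => c; rewrite inE.
  case/andP=> /imfsetP[z _ ->] /in_cells[k _ [/= H _]]; lia.
rewrite cardfs0 subn0 card_imfset /=; last by move=> z z' [].
by rewrite undup_id ?col_seq_uniq // size_col_seq.
Qed.

Lemma column_cells i w k : (k < size w)%N ->
  is_column (column (cells i w) (i + k%:Z)) (i + k%:Z) (nth col0 w k).
Proof.
move=> kw c; rewrite !inE; split=> [/andP[/in_cells[l lw [cl xl]] /eqP ck]|].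
  by move: cl xl; rewrite ck => /addrI[<-].
case=> ck cx; rewrite ck eqxx andbT; apply/in_cells.
by exists k.
Qed.

Lemma column_indices_cells m i w k :
  all (fun x : col => valid_shape m x.2) w ->
  k \in column_indices (cells i w) <-> i <= k < i + (size w)%:Z.
Proof.
move=> /allP wv; split=> [/imfsetP[c /= /in_cells[l lw [cl _]] ->]|Hk];
  first by lia.
have kw : (absz (k - i)%R < size w)%N by lia.
apply/imfsetP; have := wv _ (mem_nth col0 kw).
case E: (nth col0 w _) => [u [[c h] d]] /= Hv.
exists (k, u) => //=; apply/in_cells; exists (absz (k - i)%R) => //=.
by rewrite E /=; split; lia.
Qed.

(** * Cheesy polyominoes as words *)

(* The left neighbours of (i + 1, z) are (i, z) and (i, z + 1), so a run
   [u, u + n) touches a run [s, s + a) when it meets [s - 1, s + a). *)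
Definition touch_run (x : col) (u : int) (n : nat) : bool :=
  let: (s, (a, g, b)) := x in
  ((u < s + a%:Z) && (s <= u + n%:Z)) ||
  [&& (0 < b)%N, u < s + (a + g + b)%:Z & s + (a + g)%:Z <= u + n%:Z].

Definition touch (x y : col) : bool :=
  let: (u, (c, h, d)) := y in
  touch_run x u c && ((d == 0)%N || touch_run x (u + (c + h)%:Z) d).

Lemma touch_runP m (x : col) u n : valid_shape m x.2 -> (0 < n)%N ->
  touch_run x u n <->
  exists2 z, u <= z < u + n%:Z & in_col x z || in_col x (z + 1).
Proof.
case: x => s [[a g] b] /= /and3P[a0 _ gb] n0; split=> [|[z]]; last by lia.
case/orP=> [/andP[H1 H2]|/and3P[b0 H1 H2]].
  have [us|us] := lerP s u; first by exists u; lia.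
  by exists (s - 1); lia.
have [us|us] := lerP (s + (a + g)%:Z) u; first by exists u; lia.
by exists (s + (a + g)%:Z - 1); lia.
Qed.

Lemma share_edge_left i z z' :
  share_edge (i + 1, z) (i, z') = (z' == z) || (z' == z + 1).
Proof. rewrite /share_edge /= !inE !xpair_eqE /=; lia. Qed.

Lemma columns_touch m (A B : {fset cell}) i x y :
  valid_shape m x.2 -> valid_shape m y.2 ->
  is_column A i x -> is_column B (i + 1) y ->
  (forall C, C \in components B ->
     exists c d, [/\ c \in C, d \in A & share_edge c d]) <-> touch x y.
Proof.
case: y => u [[c h] d] xv /= /and3P[c0 _ hd] colA colB.
have run_touch (C : {fset cell}) v n : (0 < n)%N ->
    (forall e : cell, e \in C <-> e.1 = i + 1 /\ v <= e.2 < v + n%:Z) ->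
    (exists c d, [/\ c \in C, d \in A & share_edge c d]) <-> touch_run x v n.
  move=> n0 CP; split=> [[[e1 e2] [[f1 f2] [/CP[/= -> He] /colA[/= -> xf]]]]|].
    rewrite share_edge_left => ef; apply/(touch_runP v xv n0); exists e2 => //.
    by case/orP: ef xf => /eqP-> -> //; rewrite orbT.
  case/(touch_runP v xv n0) => z Hz /orP[] xz.
    by exists (i + 1, z), (i, z); split;
      [apply/CP | apply/colA|rewrite share_edge_left eqxx].
  by exists (i + 1, z), (i, z + 1); split;
    [apply/CP | apply/colA | rewrite share_edge_left eqxx orbT].
have cs := column_components colB c0 hd.
have lowP := run_touch _ u c c0 (in_low colB c0 hd).
pose high := [fset e : cell in B | ~~ (e.2 < u + c%:Z)].
have highP : d <> 0%N -> (exists e f, [/\ e \in high, f \in A & share_edge e f])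
    <-> touch_run x (u + (c + h)%:Z) d.
  move=> dn0; apply: run_touch; first by lia.
  by move=> e; rewrite -addrA -PoszD; exact: (in_high colB c0 hd).
split=> [H|/andP[t1 t2] C /cs[->|[dn0 ->]]].
- apply/andP; split; first by apply/lowP/H/cs; left.
  by have [//|/eqP dn0] := eqVneq d 0%N; apply/highP/H/cs => //; right.
- exact/lowP.
- by apply/highP => //; case/orP: t2 => // /eqP.
Qed.

Definition is_single (x : col) : bool := x.2.2 == 0%N.

Definition good_word (m : nat) (w : seq col) : bool :=
  [&& w != [::], all (fun x : col => valid_shape m x.2) w, sorted touch w &
      is_single (head col0 w)].

Lemma rsd_cells m i w : good_word m w -> rightward_semi_directed (cells i w).
Proof.
case/and4P=> wn0 wv wt wh; have w0 : (0 < size w)%N by case: (w) wn0.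
have wvk k : (k < size w)%N -> valid_shape m (nth col0 w k).2.
  by move=> kw; apply: (allP wv); apply: mem_nth.
split=> [j [/(column_indices_cells _ _ wv) Hj jmin]|j l [/(column_indices_cells
  _ _ wv) Hj]].
  have ji : j = i.
    by have : j <= i by [apply/jmin/(column_indices_cells _ _ wv); lia]; lia.
  have := column_cells i w0; have := wvk _ w0; rewrite addr0 nth0 ji.
  move: wh; case: (head _ _) => u [[c h] d] /= /eqP d0 /and3P[c0 _ hd] cc.
  exact/(column_connected cc c0 hd).
move=> /(column_indices_cells _ _ wv) Hl jl nb.
have lj : l = j + 1.
  have : ~~ (j < j + 1 < l); last by lia.
  by apply/nb/(column_indices_cells _ _ wv); lia.
have [k kw jk] : exists2 k, (k.+1 < size w)%N & j = i + k%:Z.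
  by exists (absz (j - i)%R); lia.
have colj := column_cells i (ltnW kw); have coll := column_cells i kw.
have lk : l = i + k.+1%:Z by lia.
rewrite -lk lj in coll; rewrite -jk in colj; rewrite lj.
apply/(columns_touch (wvk _ (ltnW kw)) (wvk _ kw) colj coll).
by move/(sortedP col0): wt; apply.
Qed.

(** By induction on the column, every cell is joined to one fixed cell of the first column: its
    component within its own column shares an edge with the column on the left, and the first column
    is connected. *)
Lemma connected_cells_word m i w : good_word m w -> connected_cells (cells i w).
Proof.
move=> gw; have [_ rsd] := rsd_cells i gw; have [fc _] := rsd_cells i gw.
case/and4P: gw => wn0 wv _ _; have w0 : (0 < size w)%N by case: (w) wn0.
have sub k : column (cells i w) k `<=` cells i w.
  by apply/fsubsetP => c; rewrite !inE => /andP[].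
have idx k : (k < size w)%N -> i + k%:Z \in column_indices (cells i w).
  by move=> kw; apply/(column_indices_cells _ _ wv); lia.
have /imfsetP[o /= oA io] := idx _ w0.
suff H k : (k < size w)%N -> forall c, c \in column (cells i w) (i + k%:Z) ->
    reach (cells i w) o c.
  apply/connected_cellsP => c d cA dA.
  have colP e : e \in cells i w -> reach (cells i w) o e.
    move=> eA; have /in_cells[k kw [ek _]] := eA.
    by apply: (H k kw); rewrite !inE eA ek eqxx.
  exact: (reach_trans (reach_sym (colP _ cA)) (colP _ dA)).
elim: k => [|k IH] kw c cA.
  apply: (reach_sub (sub (i + 0))).
  have fc0 : first_column (cells i w) (i + 0).
    split; first exact: (idx 0%N).
    by move=> k /(column_indices_cells _ _ wv); lia.
  apply: ((connected_cellsP _).1 (fc _ fc0)) => //.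
  by rewrite !inE oA -io eqxx.
have adj : adjacent_columns (cells i w) (i + k%:Z) (i + k.+1%:Z).
  by split; [apply: idx; lia | exact: idx | lia | move=> l _; lia].
pose C := [fset e : cell in column (cells i w) (i + k.+1%:Z)
             | `[<reach (column (cells i w) (i + k.+1%:Z)) c e>]].
have inC e : (e \in C) = (e \in column (cells i w) (i + k.+1%:Z)) &&
    `[<reach (column (cells i w) (i + k.+1%:Z)) c e>] by rewrite !inE.
have /(rsd _ _ adj)[e [f [eC fA ef]]] : C \in components (column (cells i w) (i
  + k.+1%:Z)).
  apply/in_components; exists c => // e; rewrite inC.
  by split=> [/andP[eA /asboolP]//|[eA ce]]; apply/andP; split=> //;
    apply/asboolP.
move: eC; rewrite inC => /andP[eB /asboolP ce].
apply: (reach_trans (IH (ltnW kw) _ fA)).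
apply: reach_trans (reach_sub (sub _) (reach_sym ce)).
by apply: reach_step; rewrite ?(share_edge_sym f) //;
  apply: (fsubsetP (sub _)); eassumption.
Qed.

Lemma cheesy_cells m i w : good_word m w -> cheesy m (cells i w).
Proof.
move=> gw; have /and4P[wn0 wv _ _] := gw.
have colk k : k \in column_indices (cells i w) -> exists u c h d,
    [/\ is_column (column (cells i w) k) k (u, (c, h, d)), (0 < c)%N,
      (h == 0%N) == (d == 0%N) & (h <= m)%N].
  move=> /(column_indices_cells _ _ wv) Hk.
  have kw : (absz (k - i)%R < size w)%N by lia.
  have := column_cells i kw; have := allP wv _ (mem_nth col0 kw).
  have -> : i + (absz (k - i)%R)%:Z = k by lia.
  case: nth => u [[c h] d] /= /and3P[c0 hm hd] cc.
  by exists u, c, h, d.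
split.
- rewrite /polyomino (connected_cells_word i gw) andbT.
  have /imfsetP[c /= cA _] : i \in column_indices (cells i w).
    by apply/(column_indices_cells _ _ wv); case: (w) wn0 => //= _ v _; lia.
  by apply/fset0Pn; exists c.
- exact: rsd_cells gw.
- move=> k /colk[u [c [h [d [cc c0 hd _]]]]];
  exact: column_card_components cc c0 hd.
- move=> k C D /colk[u [c [h [d [cc c0 hd hm]]]]].
  exact: ((column_gap cc c0 hd m).2 hm).
Qed.

Lemma cheesy_word m (P : {fset cell}) : cheesy m P ->
  exists i w, good_word m w /\ P = cells i w.
Proof.
case=> /andP[/fset0Pn[o oP] _] [fc rsd] card2 gap.
pose idx (k : int) := k \in column_indices P.
pose B := \max_(k <- column_indices P) absz k.
have idxB k : idx k -> (absz k <= B)%N.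
  by move=> Pk; exact: (@leq_bigmax_seq _ _ xpredT absz k).
have oidx : idx o.1 by apply/imfsetP; exists o.
have [i ii imin] := int_min idxB oidx.
have [n n0 [ni nni]] := int_run idxB ii.
have col_neq0 k : idx k -> column P k != fset0.
  case/imfsetP=> c /= cP ->; apply/fset0Pn; exists c.
  by rewrite !inE cP eqxx.
have colE k (c : cell) : c \in column P k -> c.1 = k.
  by rewrite !inE => /andP[_ /eqP].
(* The occupied abscissas form an interval. Otherwise the first column [l] past the missing abscissa
   [i + n] would be adjacent, in the order of columns, to column [i + n - 1]; their abscissas differ
   by at least two, so they share no edge. *)
have imax k : idx k -> k < i + n%:Z.
  move=> Pk; rewrite ltNge; apply/negP => kn.
  pose idx' (l : int) := idx l && (i + n%:Z <= l).
  have idx'B l : idx' l -> (absz l <= B)%N by case/andP => /idxB.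
  have [|l /andP[Pl ln] lmin] := @int_min idx' B k idx'B; first by apply/andP.
  have adj : adjacent_columns P (i + n%:Z - 1) l.
    split=> //; [by apply: ni; lia | by lia |move=> j Pj].
    by apply/negP => Hj; have : l <= j; [apply: lmin; rewrite /idx' /idx Pj|];
      lia.
  have /fset0Pn[c cl] := col_neq0 _ Pl.
  pose C := [fset e : cell in column P l | `[<reach (column P l) c e>]].
  have inC e : (e \in C) = (e \in column P l) && `[<reach (column P l) c e>].
    by rewrite !inE.
  have /(rsd _ _ adj)[[e1 e2] [[f1 f2] [eC /colE/= fA ef]]] :
      C \in components (column P l).
    apply/in_components; exists c => // e; rewrite inC.
    by split=> [/andP[eA /asboolP]//|[eA ce]]; apply/andP; split=> //;
      apply/asboolP.
  move: eC; rewrite inC => /andP[/colE/= eB _].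
  have : l != i + n%:Z by apply: contraNneq nni => <-.
  move: ef; rewrite /share_edge /= !inE !xpair_eqE /=; lia.
have /choice[f Hf] : forall k : nat, exists x : col, (k < n)%N ->
    is_column (column P (i + k%:Z)) (i + k%:Z) x /\ valid_shape m x.2.
  move=> k; have [kn|kn] := ltnP k n; last by exists col0.
  have Pk : idx (i + k%:Z) by apply: ni; lia.
  have [u [c [h [d [cc c0 hd]]]]] :=
    is_column_exists (col_neq0 _ Pk) (@colE _) (card2 _ Pk).
  exists (u, (c, h, d)) => _; split=> //=; rewrite c0 hd andbT /=.
  by apply/(column_gap cc c0 hd) => C D CA DA; apply: gap.
have fnth k : (k < n)%N -> nth col0 (mkseq f n) k = f k by move=> kn;
  rewrite nth_mkseq.
exists i, (mkseq f n); split.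
  apply/and4P; split.
  - by rewrite -size_eq0 size_mkseq; lia.
  - apply/(all_nthP col0) => k; rewrite size_mkseq => kn.
    by rewrite fnth //; have [] := Hf _ kn.
  - apply/(sortedP col0) => k; rewrite size_mkseq => kn.
    rewrite !fnth //; last exact: ltnW.
    have [colk vk] := Hf _ (ltnW kn); have [colk1 vk1] := Hf _ kn.
    have e : i + k.+1%:Z = i + k%:Z + 1 by lia.
    rewrite e in colk1.
    apply/(columns_touch vk vk1 colk colk1); apply: rsd.
    by split; [apply: ni | apply: ni | | move=> l _]; lia.
  rewrite -nth0 fnth //; have [] := Hf _ n0; rewrite addr0.
  case: (f 0%N) => u [[c h] d] cc /= /and3P[c0 _ hd].
  by apply/eqP/(column_connected cc c0 hd)/fc; split.
apply/fsetP => c; apply/idP/idP => [cP|/in_cells[k]].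
  have ic : idx c.1 by apply/imfsetP; exists c.
  have := imin _ ic; have := imax _ ic => H1 H2.
  have kn : (absz (c.1 - i)%R < n)%N by lia.
  apply/in_cells; rewrite size_mkseq; exists (absz (c.1 - i)%R) => //;
    rewrite fnth //.
  have [+ _] := Hf _ kn; have -> : i + (absz (c.1 - i)%R)%:Z = c.1 by lia.
  by move/(_ c) => [] + _; apply; rewrite !inE cP eqxx.
rewrite size_mkseq => kn; rewrite fnth // => Hc.
have [+ _] := Hf _ kn; move/(_ c) => [_ /(_ Hc)].
by rewrite !inE => /andP[].
Qed.

(** * Translations and canonical representatives *)

Definition shift (v : int) (x : col) : col := (x.1 + v, x.2).

Lemma in_col_shift v x z : in_col (shift v x) z = in_col x (z - v).
Proof. by case: x => u [[c h] d] /=; lia. Qed.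

Lemma touch_shift v x y : touch (shift v x) (shift v y) = touch x y.
Proof. by case: x y => s [[a g] b] [u [[c h] d]] /=; lia. Qed.

Lemma good_word_shift m v w : good_word m (map (shift v) w) = good_word m w.
Proof.
rewrite /good_word all_map sorted_map; case: w => [|x w] //=.
by congr [&& _, _ & _]; apply: eq_path => y z; exact: touch_shift.
Qed.

Lemma translate_cells v j i w :
  translate (j, v) (cells i w) = cells (i + j) (map (shift v) w).
Proof.
apply/fsetP => -[c1 c2];
  apply/imfsetP/idP => [[d /= /in_cells[k kw [dk xd]] [-> ->]]|/in_cells].
  apply/in_cells.
  exists k; rewrite ?size_map //= (nth_map col0) // in_col_shift addrK dk.
  by split=> //; lia.
case=> k; rewrite size_map => kw [/= c1E];
  rewrite (nth_map col0) // in_col_shift => c2E.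
exists (c1 - j, c2 - v); last by rewrite /= !subrK.
by apply/in_cells; exists k => //=; split=> //; lia.
Qed.

Lemma translate0 (P : {fset cell}) : translate (0, 0) P = P.
Proof.
apply/fsetP => c; apply/imfsetP/idP => [[d /= dP ->]|cP].
  by rewrite !addr0 -surjective_pairing.
by exists c; rewrite // !addr0 -surjective_pairing.
Qed.

Lemma in_col_inj m x y : valid_shape m x.2 -> valid_shape m y.2 ->
  in_col x =1 in_col y -> x = y.
Proof.
case: x y => u [[c h] d] [u' [[c' h'] d']] /= /and3P[c0 _ hd] /and3P[c0' _ hd']
  E.
have uu : u = u' by move: (E u) (E u') => /=; lia.
subst u'.
have cc : c = c' by move: (E (u + c%:Z)) (E (u + c'%:Z)) => /=; lia.
subst c'.
have hh : h = h'.
  by move: (E (u + (c + h)%:Z)) (E (u + (c + h')%:Z)) => /=; lia.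
subst h'.
have dd : d = d'.
  by move: (E (u + (c + h + d)%:Z)) (E (u + (c + h + d')%:Z)) => /=; lia.
by subst d'.
Qed.

Lemma cells_inj m i w i' w' : good_word m w -> good_word m w' ->
  cells i w = cells i' w' -> i = i' /\ w = w'.
Proof.
move=> /and4P[wn0 wv _ _] /and4P[wn0' wv' _ _] E.
have w0 : (0 < size w)%N by case: (w) wn0.
have w0' : (0 < size w')%N by case: (w') wn0'.
have idx k : (i <= k < i + (size w)%:Z) = (i' <= k < i' + (size w')%:Z).
  by apply/idP/idP => [/(column_indices_cells _ _ wv)|/(column_indices_cells _
    _ wv')];
    [rewrite E => /(column_indices_cells _ _ wv')
    |rewrite -E => /(column_indices_cells _ _ wv)].
have ii : i = i' by move: (idx i) (idx i'); lia.
subst i'; have ss : size w = size w'.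
  by move: (idx (i + (size w)%:Z)) (idx (i + (size w')%:Z)); lia.
split=> //; apply: (eq_from_nth (x0 := col0)) => // k kw.
have kw' : (k < size w')%N by rewrite -ss.
apply: (in_col_inj (allP wv _ (mem_nth col0 kw)) (allP wv' _ (mem_nth col0
  kw'))) => z.
have := column_cells i kw; have := column_cells i kw'; rewrite E => H' H.
apply/idP/idP => zx.
  by have /H' [] : (i + k%:Z, z) \in column (cells i w') (i + k%:Z) by apply/H.
by have /H [] : (i + k%:Z, z) \in column (cells i w') (i + k%:Z) by apply/H'.
Qed.

(** Normalises the vertical translation; taking the first column at abscissa 0 normalises the
    horizontal one. Each translation class then has exactly one word. *)
Definition anchored (w : seq col) : bool := (head col0 w).1 == 0.

Lemma translation_class_inj m w w' : good_word m w -> good_word m w' ->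
  anchored w -> anchored w' ->
  translation_class (cells 0 w) = translation_class (cells 0 w') -> w = w'.
Proof.
move=> gw gw' aw aw' E.
have : translation_class (cells 0 w') (cells 0 w).
  by rewrite -E; exists (0, 0) => //; exact: translate0.
case=> -[j v] _; rewrite translate_cells => /esym F.
have gs : good_word m (map (shift v) w') by rewrite good_word_shift.
have [_ ws] := cells_inj gw gs F.
have v0 : v = 0.
  have /and4P[wn0' _ _ _] := gw'.
  move: aw aw'; rewrite ws /anchored; case: (w') wn0' => //= x s _.
  by move=> /eqP + /eqP => H1 H2; rewrite H2 add0r in H1.
rewrite ws v0 -[RHS]map_id; apply: eq_map => -[u s]; rewrite /shift /= addr0 //.
Qed.

Lemma cheesy_classesP m n (X : set {fset cell}) : cheesy_classes m n X <->
  exists w, [/\ good_word m w, anchored w, (\sum_(x <- w) shape_size x.2)%N = n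
    &
    X = translation_class (cells 0 w)].
Proof.
split=> [[P [/= Pc Pn] <-]|[w [gw aw <- ->]]]; last first.
  by exists (cells 0 w) => //=; split;
    [exact: cheesy_cells | exact: area_cells].
have [i [w [gw PE]]] := cheesy_word Pc.
pose u := (head col0 w).1.
exists (map (shift (- u)) w); split.
- by rewrite good_word_shift.
- have /and4P[wn0 _ _ _] := gw.
  by rewrite /anchored /u; case: (w) wn0 => //= x s _; rewrite subrr.
- by rewrite big_map -Pn PE area_cells.
have PT : cells 0 (map (shift (- u)) w) = translate (- i, - u) P.
  by rewrite PE translate_cells subrr.
rewrite PT; apply/seteqP; split=> Q [[a b] _ <-].
  exists (a + i, b + u) => //; rewrite PE !translate_cells -map_comp.
  congr (cells _ _); first by lia.
  by apply: eq_map => x; rewrite /shift /=; congr pair; lia.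
exists (a - i, b - u) => //; rewrite PE !translate_cells -map_comp.
congr (cells _ _); first by lia.
by apply: eq_map => x; rewrite /shift /=; congr pair; lia.
Qed.

(** * Enumeration of the words *)

Definition shapes (n : nat) : seq shape :=
  (n, 0, 0)%N :: [seq (c, 1, n - c)%N | c <- iota 1 n.-1]
             ++ [seq (c, 2, n - c)%N | c <- iota 1 n.-1].

Lemma mem_shapes n s : (0 < n)%N ->
  (s \in shapes n) = valid_shape 2 s && (shape_size s == n).
Proof.
case: s => [[c h] d] n0; rewrite inE mem_cat /=; apply/idP/idP => [|H].
  case/or3P=> [/eqP[-> -> ->]|/mapP[c' + [-> -> ->]]|/mapP[c' + [-> -> ->]]];
    by rewrite ?mem_iota; lia.
have [d0|d0] := eqVneq d 0%N.
  by apply/or3P/Or31/eqP; congr (_, _, _); lia.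
have [h1|h1] := eqVneq h 1%N.
  apply/or3P/Or32/mapP; exists c; rewrite ?mem_iota; first by lia.
  by congr (_, _, _); lia.
apply/or3P/Or33/mapP; exists c; rewrite ?mem_iota; first by lia.
by congr (_, _, _); lia.
Qed.

Lemma shapes_uniq n : uniq (shapes n).
Proof.
rewrite /= cat_uniq !map_inj_uniq ?iota_uniq ?mem_cat ?andbT /=;
  try by move=> ? ? [->].
apply/andP; split; first by apply/norP; split; apply/mapP => -[c _ []].
by apply/hasPn => _ /mapP[c _ ->]; apply/mapP => -[c' _ []].
Qed.

Definition upto (n : nat) : seq shape := flatten [seq shapes m | m <- iota 1 n].

Lemma mem_upto n s : (s \in upto n) = valid_shape 2 s && (shape_size s <= n)%N.
Proof.
apply/flatten_mapP/idP => [[m]|/andP[sv sn]].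
  by rewrite mem_iota => mn; rewrite mem_shapes; lia.
have s0 : (0 < shape_size s)%N by case: s sv {sn} => [[c h] d] /=; lia.
by exists (shape_size s); rewrite ?mem_iota ?mem_shapes ?sv ?eqxx //; lia.
Qed.

Lemma upto_uniq n : uniq (upto n).
Proof.
rewrite /upto; elim: n => // n IH.
rewrite -[n.+1]addn1 iotaD map_cat flatten_cat cat_uniq IH.
rewrite (_ : flatten [seq shapes m | m <- iota (1 + n) 1] = shapes n.+1)
  ?shapes_uniq ?andbT; last by rewrite /= cats0.
apply/hasPn => s; rewrite mem_shapes; last by lia.
by rewrite -/(upto n) mem_upto => /andP[-> /eqP->]; lia.
Qed.

Definition height (s : shape) : nat := let: (a, g, b) := s in (a + g + b)%N.

(* k is the offset of the next column, counted from the lowest position at which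
   its lower run can touch a column of shape s with lowest cell 0. *)
Definition contact (s t : shape) (k : nat) : bool :=
  touch (0, s) (k%:Z - t.1.1%:Z, t).

Definition transitions (s t : shape) : nat :=
  count (contact s t) (iota 0 (height s + t.1.1)).

Definition placements (x : col) (t : shape) : seq col :=
  [seq (x.1 - t.1.1%:Z + k%:Z, t) | k <- iota 0 (height x.2 + t.1.1) & contact
    x.2 t k].

Lemma size_placements x t : size (placements x t) = transitions x.2 t.
Proof. by rewrite size_map size_filter. Qed.

Lemma contactE (x : col) t k :
  contact x.2 t k = touch x (x.1 - t.1.1%:Z + k%:Z, t).
Proof.
rewrite /contact -(touch_shift x.1); congr (touch _ _); rewrite /shift /=.
  by rewrite add0r -surjective_pairing.
by congr pair; lia.
Qed.

(** The finite window loses nothing: to touch [x], the lower run must end no lower than the bottom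
    of [x] and start below its top, which leaves [height x.2 + t.1.1] offsets to test. *)
Lemma mem_placements (x : col) t y : (y \in placements x t) = (y.2 == t) &&
  touch x y.
Proof.
case: y => u t'; apply/mapP/andP => [[k + [-> ->]]|[/eqP E tx]].
  by rewrite mem_filter contactE => /andP[xk _]; rewrite eqxx.
rewrite /= in E; subst t'.
have H : (0 <= u - (x.1 - t.1.1%:Z)) && (u - (x.1 - t.1.1%:Z) < (height x.2 +
  t.1.1)%:Z).
  move: tx; case: x t => s [[a g] b] [[c h] d] /=; lia.
have e : u = x.1 - t.1.1%:Z + (absz (u - (x.1 - t.1.1%:Z))%R)%:Z by lia.
exists (absz (u - (x.1 - t.1.1%:Z))%R); last by rewrite -e.
by rewrite mem_filter contactE -e tx mem_iota; lia.
Qed.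

Lemma placements_uniq x t : uniq (placements x t).
Proof.
rewrite map_inj_uniq ?filter_uniq ?iota_uniq // => k k' [] /addrI; lia.
Qed.

(** Here [n] is the area still to be placed. Every column has at least one cell, so any fuel not
    below [n] gives the complete list. *)
Fixpoint extensions (fuel n : nat) (x : col) : seq (seq col) :=
  if n == 0%N then [:: [::]] else
  if fuel is k.+1 then
    [seq y :: w | y <- [seq y | t <- upto n, y <- placements x t],
                  w <- extensions k (n - shape_size y.2) y]
  else [::].

Lemma mem_next n x y : (y \in [seq y | t <- upto n, y <- placements x t]) =
  [&& valid_shape 2 y.2, (shape_size y.2 <= n)%N & touch x y].
Proof.
apply/allpairsPdep/idP => [[t [z [/= + + ->]]]|/and3P[yv yn xy]].
  by rewrite mem_upto mem_placements => /andP[tv tn] /andP[/eqP-> ->];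
    rewrite tv tn.
by exists y.2, y; rewrite mem_upto mem_placements yv yn xy eqxx.
Qed.

Lemma next_uniq n x : uniq [seq y | t <- upto n, y <- placements x t].
Proof.
apply: allpairs_uniq_dep => [|t _|].
- exact: upto_uniq.
- exact: placements_uniq.
move=> [t y] [t' y'] /allpairsPdep[s [z [_ + [-> ->]]]] /allpairsPdep[s' [z' [_
  + [-> ->]]]].
by rewrite !mem_placements => /andP[/eqP<- _] /andP[/eqP<- _] /= ->.
Qed.

Lemma extensions_uniq k n x : uniq (extensions k n x).
Proof.
elim: k n x => [|k IH] n x /=; case: ifP => // _.
apply: allpairs_uniq_dep => [|y _|]; [exact: next_uniq | exact: IH |].
by move=> [y w] [y' w'] _ _ /= [-> ->].
Qed.

Lemma mem_extensions k n x w : (n <= k)%N ->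
  (w \in extensions k n x) =
  [&& all (fun x : col => valid_shape 2 x.2) w, path touch x w &
      (\sum_(x <- w) shape_size x.2)%N == n].
Proof.
have pos (y : col) : valid_shape 2 y.2 -> (0 < shape_size y.2)%N.
  by case: y => u [[c h] d] /=; lia.
elim: k n x w => [|k IH] n x w nk /=; case: ifP => [/eqP n0|n0].
- rewrite n0; case: w => [|y w]; rewrite inE ?big_nil //= big_cons addn_eq0.
  by apply/esym/negP => /and3P[/andP[/pos y0 _] _ /andP[/eqP y1 _]];
    rewrite y1 in y0.
- by lia.
- rewrite n0; case: w => [|y w]; rewrite inE ?big_nil //= big_cons addn_eq0.
  by apply/esym/negP => /and3P[/andP[/pos y0 _] _ /andP[/eqP y1 _]];
    rewrite y1 in y0.
have step (y : col) : valid_shape 2 y.2 -> (n - shape_size y.2 <= k)%N.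
  by move=> yv; apply: leq_trans (leq_sub2l n (pos _ yv)) _; lia.
apply/allpairsPdep/idP => [[y [v [+ + ->]]]|].
  rewrite mem_next => /and3P[yv yn xy]; rewrite IH ?step //.
  by move=> /and3P[vv vt /eqP vn];
    rewrite /= yv vv xy vt big_cons vn subnKC //=.
case: w => [|y w]; first by rewrite big_nil eq_sym n0.
rewrite /= big_cons => /and3P[/andP[yv wv] /andP[xy wt] /eqP wn].
exists y, w; rewrite mem_next yv xy IH ?step // wv wt -wn leq_addr addKn eqxx.
by split.
Qed.

Fixpoint weight (fuel n : nat) (s : shape) : nat :=
  if n == 0%N then 1%N else
  if fuel is k.+1 then
    (\sum_(t <- upto n) transitions s t * weight k (n - shape_size t) t)%N
  else 0%N.

Lemma size_extensions k n x : size (extensions k n x) = weight k n x.2.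
Proof.
elim: k n x => [|k IH] n x /=; case: ifP => // _.
rewrite size_allpairs_dep sumnE big_map big_flatten big_map.
apply: eq_bigr => t _; rewrite -size_placements.
rewrite map_id (eq_big_seq (fun _ => weight k (n - shape_size t) t)).
  by rewrite big_const_seq count_predT iter_addn_0 mulnC.
by move=> y; rewrite mem_placements => /andP[/eqP<- _]; rewrite IH.
Qed.

Lemma weight_fuel k l n s : (n <= k)%N -> (n <= l)%N ->
  weight k n s = weight l n s.
Proof.
elim: k l n s => [|k IH] [|l] n s nk nl /=; case: ifP => // n0; try by lia.
apply: eq_big_seq => t; rewrite mem_upto => /andP[tv tn].
have t0 : (0 < shape_size t)%N by case: t tv {tn} => [[c h] d] /=; lia.
by rewrite (IH l) //; lia.
Qed.

Definition completions (n : nat) (s : shape) : nat := weight n n s.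

Lemma completionsS n s : (0 < n)%N -> completions n s =
  (\sum_(m <- iota 1 n) \sum_(t <- shapes m) transitions s t * completions (n -
    m) t)%N.
Proof.
case: n => // n _; rewrite /completions {1}/weight -/weight /= big_flatten
  big_map.
apply: eq_big_seq => m; rewrite mem_iota => Hm; apply: eq_big_seq => t.
have m0 : (0 < m)%N by lia.
rewrite (mem_shapes _ m0) => /andP[_ /eqP->]; congr (_ * _)%N.
by apply: weight_fuel => //; lia.
Qed.

Definition words (n : nat) : seq (seq col) :=
  [seq (0, (c, 0, 0)%N) :: w | c <- iota 1 n,
                               w <- extensions n (n - c) (0, (c, 0, 0)%N)].

Lemma mem_words n w : (w \in words n) =
  [&& good_word 2 w, anchored w & (\sum_(x <- w) shape_size x.2)%N == n].
Proof.
apply/allpairsPdep/idP => [[c [v [/= + + ->]]]|].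
  rewrite mem_iota mem_extensions; last exact: leq_subr.
  move=> Hc /and3P[vv vt /eqP vn].
  rewrite /good_word /anchored big_cons /= vv vt vn /is_single /=; lia.
case: w => [|[u [[c h] d]] w]; first by case/andP.
case/and3P=> /and4P[_ /= /andP[xv wv] wt /eqP /= d0] /eqP /= u0.
rewrite big_cons /= => /eqP wn; have [h0 c0] : h = 0%N /\ (0 < c)%N by lia.
subst h d u; exists c, w; split=> //; first by rewrite mem_iota; lia.
by rewrite mem_extensions ?leq_subr // wv wt -wn addn0 addKn eqxx.
Qed.

Lemma words_uniq n : uniq (words n).
Proof.
apply: allpairs_uniq_dep => [|c _|];
  [exact: iota_uniq | exact: extensions_uniq |].
by move=> [c w] [c' w'] _ _ /= [-> ->].
Qed.

Lemma size_words n :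
  size (words n) = (\sum_(c <- iota 1 n) completions (n - c) (c, 0, 0))%N.
Proof.
rewrite size_allpairs_dep sumnE big_map; apply: eq_bigr => c _.
by rewrite size_extensions; apply: weight_fuel; rewrite ?leq_subr.
Qed.

Definition word_class (w : seq col) : set {fset cell} :=
  translation_class (cells 0 w).

Lemma cheesy_classes_words n :
  cheesy_classes 2 n = [set` [fset word_class w | w in words n]]%classic.
Proof.
apply/seteqP; split=> X.
  case/cheesy_classesP=> w [gw aw wn ->] /=; apply/imfsetP; exists w => //=.
  by rewrite mem_words gw aw wn eqxx.
move=> /= /imfsetP[w /=]; rewrite mem_words => /and3P[gw aw /eqP wn] ->.
by apply/cheesy_classesP; exists w.
Qed.

Lemma finite_cheesy_classes n : finite_set (cheesy_classes 2 n).
Proof. by rewrite cheesy_classes_words; exact: finite_fset. Qed.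

Lemma cheesy_gfE n : cheesy_gf 2 n =
  \sum_(c <- iota 1 n) (completions (n - c) (c, 0, 0)%N)%:Z.
Proof.
rewrite /cheesy_gf cheesy_classes_words set_fsetK card_in_imfset /=.
  rewrite undup_id ?words_uniq // size_words.
  by rewrite -natz (big_morph (fun k : nat => k%:R : int) (@natrD _) (erefl _));
    apply: eq_bigr => c _; rewrite natz.
move=> w w'; rewrite !mem_words => /and3P[gw aw _] /and3P[gw' aw' _].
exact: (translation_class_inj gw gw' aw aw').
Qed.

(** * Number of offsets *)

Lemma count_iota_lt (h n : nat) : count (fun k =>
  (k < h)%N) (iota 0 n) = minn h n.
Proof.
elim: n => [|n IH]; first by rewrite /= minn0.
by rewrite -[n.+1]addn1 iotaD count_cat IH /=; lia.
Qed.

Lemma count_iota_eq (P : bool) (e n : nat) :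
  count (fun k => P && (k == e)) (iota 0 n) = (P && (e < n)%N : nat).
Proof.
elim: n => [|n IH]; first by rewrite andbF.
by rewrite -[n.+1]addn1 iotaD count_cat IH /=; lia.
Qed.

(** The admissible offsets form the initial segment below [N] with at most two exceptional offsets
    [e1], [e2] removed. Exceptions are added on the left so that no truncated subtraction occurs. *)
Lemma count_contact (s t : shape) (N e1 e2 : nat) (P1 P2 : bool) :
  (forall k, contact s t k + (P1 && (k == e1)) + (P2 && (k == e2)) = (k < N)%N
    :> nat)%N ->
  (N <= height s + t.1.1)%N ->
  (transitions s t + (P1 && (e1 < height s + t.1.1)%N)
                   + (P2 && (e2 < height s + t.1.1)%N) = N)%N.
Proof.
move=> E /minn_idPl <-; rewrite -count_iota_lt /transitions -!count_iota_eq.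
by elim: iota => //= k r <-; rewrite -E; lia.
Qed.

Lemma transitions_single_single (a c : nat) : (0 < a)%N -> (0 < c)%N ->
  transitions (a, 0, 0) (c, 0, 0) = (a + c)%N.
Proof.
move=> a0 c0.
rewrite -[RHS](@count_contact (a, 0, 0) (c, 0, 0) (a + c) 0 0 false false)%N /=
  ?addn0 //.
by move=> k; rewrite /contact /=; lia.
Qed.

(** At offset [k] the upper run starts at height [k + h], which must stay below [a]. The truncation
    of [a - h] matters: for [a = 1] and [h = 2] the count is 0. *)
Lemma transitions_single_double (a c h d : nat) : (0 < a)%N -> (0 < c)%N ->
  (0 < d)%N ->
  transitions (a, 0, 0) (c, h, d) = (a - h)%N.
Proof.
move=> a0 c0 d0.
rewrite -[RHS](@count_contact (a, 0, 0) (c, h, d) (a - h) 0 0 false false)%N /=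
  ?addn0 //; last by lia.
by move=> k; rewrite /contact /=; lia.
Qed.

(** A gap of size one is invisible to a run, which always has two consecutive cells as left
    neighbours; the count is that for a solid column of height [a + 1 + b]. *)
Lemma transitions_gap1_single (a b c : nat) : (0 < a)%N -> (0 < b)%N ->
  (0 < c)%N ->
  transitions (a, 1, b) (c, 0, 0) = (a + b + c + 1)%N.
Proof.
move=> a0 b0 c0.
rewrite -[RHS](@count_contact (a, 1, b) (c, 0, 0) (a + b + c + 1) 0 0 false
  false)%N /= ?addn0 //; last by lia.
by move=> k; rewrite /contact /=; lia.
Qed.

Lemma transitions_gap1_double (a b c h d : nat) :
  (0 < a)%N -> (0 < b)%N -> (0 < c)%N -> (0 < d)%N ->
  transitions (a, 1, b) (c, h, d) = (a + b + 1 - h)%N.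
Proof.
move=> a0 b0 c0 d0.
rewrite -[RHS](@count_contact (a, 1, b) (c, h, d) (a + b + 1 - h) 0 0 false
  false)%N /= ?addn0 //; last by lia.
by move=> k; rewrite /contact /=; lia.
Qed.

(* Past a gap of size two, the offset at which a run of length one occupies the
   cell z = a has to be discarded: it has no neighbour in the previous column.
     *)
Lemma transitions_gap2_single (a b c : nat) : (0 < a)%N -> (0 < b)%N ->
  (0 < c)%N ->
  (transitions (a, 2, b) (c, 0, 0) + (c == 1))%N = (a + b + c + 2)%N.
Proof.
move=> a0 b0 c0.
(* For [c = 1] the run at offset [k] is the cell at height [k - 1], so the excluded offset is
   [a.+1]. *)
rewrite -[RHS](@count_contact (a, 2, b) (c, 0, 0) (a + b + c + 2) a.+1 0 (c ==
  1) false)%N /= ?addn0; last by lia.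
  by congr addn; lia.
by move=> k; rewrite /contact /=; lia.
Qed.

(** A run of length one must avoid height [a]. The lower run is there at offset [a + 1], which lies
    in the range only if [h <= b]; the upper run is there at offset [a - h], which exists only if
    [h <= a]. The two offsets differ, so nothing is subtracted twice. *)
Lemma transitions_gap2_double (a b c h d : nat) :
  (0 < a)%N -> (0 < b)%N -> (0 < c)%N -> (0 < d)%N -> (0 < h <= 2)%N ->
  (transitions (a, 2, b) (c, h, d) + ((c == 1) && (h <= b)) + ((d == 1) && (h
    <= a)))%N
  = (a + b + 2 - h)%N.
Proof.
move=> a0 b0 c0 d0 h0.
rewrite -[RHS](@count_contact (a, 2, b) (c, h, d) (a + b + 2 - h) a.+1 (a - h)
  ((c == 1) && (h <= b)) ((d == 1) && (h <= a)))%N /=; last by lia.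
  by congr (_ + _ + _)%N; lia.
by move=> k; rewrite /contact /=; lia.
Qed.

(** * The ring of power series and the linear system *)

(* An alias of fps, on which the product is convolution: the type nat -> int
   already carries the pointwise ring structure. *)
Definition pseries : Type := nat -> int.
HB.instance Definition _ := GRing.Zmodule.copy pseries (nat -> int).

Implicit Types (f g h : pseries).

Definition truncation (N : nat) f : {poly int} := \poly_(i < N) f i.

(** A coefficient of a product depends on finitely many coefficients of the factors; commutativity
    and associativity are thus inherited from polynomials. *)
Lemma fps_mul_truncation N f g n : (n < N)%N ->
  fps_mul f g n = (truncation N f * truncation N g)`_n.
Proof.
move=> nN; rewrite coefM; apply: eq_bigr => i _.
have iN : (i < N)%N by apply: leq_trans nN; apply: ltn_ord.
by rewrite !coef_poly iN (leq_ltn_trans (leq_subr i n) nN).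
Qed.

Lemma fps_mulC : commutative (fps_mul : pseries -> pseries -> pseries).
Proof.
by move=> f g; apply: funext => n; rewrite !(@fps_mul_truncation n.+1) // mulrC.
Qed.

Lemma fps_mulA : associative (fps_mul : pseries -> pseries -> pseries).
Proof.
move=> f g h; apply: funext => n.
transitivity ((truncation n.+1 f * truncation n.+1 g * truncation n.+1 h)`_n).
  rewrite -mulrA (@fps_mul_truncation n.+1) // !coefM.
  apply: eq_bigr => i _; congr (_ * _).
  rewrite coef_poly ltnS leq_subr (@fps_mul_truncation n.+1) //.
  by rewrite ltnS leq_subr.
rewrite [RHS](@fps_mul_truncation n.+1) // !coefM.
apply: eq_bigr => i _; congr (_ * _).
by rewrite coef_poly ltn_ord (@fps_mul_truncation n.+1).
Qed.

Lemma fps_mulDl :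
  left_distributive (fps_mul : pseries -> pseries -> pseries) +%R.
Proof.
move=> f g h; apply: funext => n.
rewrite -[RHS]/(fps_mul f h n + fps_mul g h n) /fps_mul -big_split.
by apply: eq_bigr => i _; rewrite mulrDl.
Qed.

Definition fps_one : pseries := fun n => (n == 0)%:R.

Lemma fps_mul1 : left_id fps_one (fps_mul : pseries -> pseries -> pseries).
Proof.
move=> f; apply: funext => n; rewrite /fps_mul big_ord_recl mul1r subn0.
by rewrite big1 ?addr0 // => i _; rewrite mul0r.
Qed.

Lemma fps_one_neq0 : fps_one != 0.
Proof. by apply/eqP => /(congr1 (@^~ 0%N)). Qed.

HB.instance Definition _ := GRing.Zmodule_isComNzRing.Build pseries
  fps_mulA fps_mulC fps_mul1 fps_mulDl fps_one_neq0.

Definition qvar : pseries := fun n => (n == 1)%:R.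

Lemma pseries_addE f g n : (f + g) n = f n + g n. Proof. by []. Qed.
Lemma pseries_oppE f n : (- f) n = - f n. Proof. by []. Qed.
Lemma pseries_mulE f g n : (f * g) n = \sum_(k < n.+1) f k * g (n - k)%N.
Proof. by []. Qed.

Lemma qvar_mulE f n : (qvar * f) n = if n is k.+1 then f k else 0.
Proof.
rewrite pseries_mulE; case: n => [|n]; first by rewrite big_ord1 mul0r.
rewrite big_ord_recl mul0r add0r big_ord_recl mul1r subSS subn0.
by rewrite big1 ?addr0 // => i _; rewrite mul0r.
Qed.

Lemma onesubq_mulI f : (1 - qvar) * f = 0 -> f = 0.
Proof.
move=> /(congr1 (fun g : pseries => g _)) E; apply: funext => n.
elim: n => [|n IH]; [move: (E 0%N)|move: (E n.+1)];
  by rewrite mulrBl mul1r pseries_addE pseries_oppE qvar_mulE ?IH subr0.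
Qed.

Definition pseries_of_poly : {poly int} -> pseries := fps_of_poly.

Lemma pseries_of_poly_zmod_morphism : zmod_morphism pseries_of_poly.
Proof. by move=> p r; apply: funext => n; apply: coefB. Qed.

Lemma pseries_of_poly_monoid_morphism : monoid_morphism pseries_of_poly.
Proof.
by split=> [|p r]; apply: funext => n; [apply: coef1 | apply: coefM].
Qed.

HB.instance Definition _ := GRing.isZmodMorphism.Build {poly int} pseries
  pseries_of_poly pseries_of_poly_zmod_morphism.
HB.instance Definition _ := GRing.isMonoidMorphism.Build {poly int} pseries
  pseries_of_poly pseries_of_poly_monoid_morphism.

Lemma pseries_of_polyX : pseries_of_poly 'X = qvar.
Proof. by apply: funext => n; apply: coefX. Qed.

(** The factor [u ^+ 3] stays in the conclusion because [u] need not be cancellable in a general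
    ring. *)
Lemma linear_system_elimination (A : comNzRingType) (q K K' K1 P Q Ps Qs : A) :
  let u := 1 - q in
  let S := K + P + Q in let R := 1 + K' - P - 2 * Q in
  let V := 1 + K + K' - Q in let W := 1 + 2 * K + K' - K1 + P - Ps - Qs in
  u ^+ 2 * K = q * S + q * u * R + u ^+ 2 * q * Q ->
  u ^+ 3 * K' = q * (1 + q) * S + q * u * R + u ^+ 3 * q * Q ->
  K1 = q * (S + R + Q) ->
  u ^+ 3 * P = 2 * q ^+ 2 * S + q ^+ 2 * u * V ->
  u ^+ 3 * Q = 2 * q ^+ 2 * S + q ^+ 2 * u * W + q ^+ 2 * u ^+ 2 * Qs ->
  u ^+ 2 * Ps = 2 * q * (q * u + q) * S + 2 * q * (q * u) * V ->
  u ^+ 2 * Qs = 2 * q * (q * u + q) * S + 2 * q * (q * u) * W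
                + q ^+ 2 * (u ^+ 2 + u) * Qs ->
  u * (u * (u * ((1 - 9 * q + 27 * q ^+ 2 - 31 * q ^+ 3 + 8 * q ^+ 4 + 4 * q ^+
    5
     - 2 * q ^+ 6 + 16 * q ^+ 7 - 5 * q ^+ 8 - 16 * q ^+ 9 - 2 * q ^+ 10
     + 5 * q ^+ 11) * K
    - q * (1 - 6 * q + 11 * q ^+ 2 - 6 * q ^+ 3 - q ^+ 4 - 3 * q ^+ 6
     + 5 * q ^+ 7 + 4 * q ^+ 8 - 3 * q ^+ 9 - 3 * q ^+ 10)))) = 0.
Proof.
move=> u S R V W e1 e2 e3 e4 e5 e6 e7.
pose d1 := u ^+ 2 * K - (q * S + q * u * R + u ^+ 2 * q * Q).
pose d2 := u ^+ 3 * K' - (q * (1 + q) * S + q * u * R + u ^+ 3 * q * Q).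
pose d3 := K1 - (q * (S + R + Q)).
pose d4 := u ^+ 3 * P - (2 * q ^+ 2 * S + q ^+ 2 * u * V).
pose d5 := u ^+ 3 * Q - (2 * q ^+ 2 * S + q ^+ 2 * u * W + q ^+ 2 * u ^+ 2 *
  Qs).
pose d6 := u ^+ 2 * Ps - (2 * q * (q * u + q) * S + 2 * q * (q * u) * V).
pose d7 := u ^+ 2 * Qs - (2 * q * (q * u + q) * S + 2 * q * (q * u) * W
                + q ^+ 2 * (u ^+ 2 + u) * Qs).
(* The multipliers are the row of K in the adjugate matrix of the system, divided
   by (1 - q)^5; the determinant becomes (1 - q)^3 K_den. *)
transitivity ((1 - 9 * q + 30 * q ^+ 2 - 46 * q ^+ 3 + 31 * q ^+ 4 - 5 * q
     ^+ 5 - 4 * q ^+ 6 + 15 * q ^+ 7 - 19 * q ^+ 8 - 4 * q ^+ 9 + 8 * q ^+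
     10 + 5 * q ^+ 11 - 3 * q ^+ 12) * d1
  + (q - 6 * q ^+ 2 + 11 * q ^+ 3 - 6 * q ^+ 4 - q ^+ 5 - 3 * q ^+ 7 + 5 * q
     ^+ 8 + 4 * q ^+ 9 - 3 * q ^+ 10 - 3 * q ^+ 11) * d2
  + (- q ^+ 5 + 3 * q ^+ 6 - 3 * q ^+ 7 + 3 * q ^+ 8 - 5 * q ^+ 9 + 4 * q ^+
     10 - 2 * q ^+ 11 + 2 * q ^+ 12 - q ^+ 13) * d3
  + (q ^+ 2 - 4 * q ^+ 3 + 5 * q ^+ 4 - q ^+ 5 - 6 * q ^+ 8 + 2 * q ^+ 9 + 3
     * q ^+ 10 + q ^+ 11) * d4
  + (q ^+ 3 - 2 * q ^+ 4 + q ^+ 5 + q ^+ 7 - q ^+ 8 - q ^+ 9 + q ^+ 10) * d5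
  + (- q ^+ 5 + q ^+ 6 + 2 * q ^+ 8 - q ^+ 9 - q ^+ 11) * d6
  + (- q ^+ 6 + q ^+ 7 + q ^+ 9 - q ^+ 10) * d7);
  last by rewrite /d1 /d2 /d3 /d4 /d5 /d6 /d7 e1 e2 e3 e4 e5 e6 e7 !subrr
    !mulr0 !addr0.
rewrite /d1 /d2 /d3 /d4 /d5 /d6 /d7 /W /V /R /S /u {d1 d2 d3 d4 d5 d6 d7 e1 e2
  e3 e4 e5 e6 e7 S R V W u}.
ring.
Qed.

Lemma rmorph_K_den (A : comNzRingType) (phi : {rmorphism {poly int} -> A}) :
  let q := phi 'X in
  phi K_den = 1 - 9 * q + 27 * q ^+ 2 - 31 * q ^+ 3 + 8 * q ^+ 4 + 4 * q ^+ 5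
     - 2 * q ^+ 6 + 16 * q ^+ 7 - 5 * q ^+ 8 - 16 * q ^+ 9 - 2 * q ^+ 10
     + 5 * q ^+ 11.
Proof.
by rewrite /K_den !(rmorphD, rmorphN, rmorphM, rmorphXn, rmorph_nat, rmorph1).
Qed.

Lemma rmorph_K_num (A : comNzRingType) (phi : {rmorphism {poly int} -> A}) :
  let q := phi 'X in
  phi K_num = q * (1 - 6 * q + 11 * q ^+ 2 - 6 * q ^+ 3 - q ^+ 4 - 3 * q ^+ 6
     + 5 * q ^+ 7 + 4 * q ^+ 8 - 3 * q ^+ 9 - 3 * q ^+ 10).
Proof.
by rewrite /K_num !(rmorphD, rmorphN, rmorphM, rmorphXn, rmorph_nat, rmorph1).
Qed.

(** * The series of continuations *)

(** Nonempty continuations, where [om] stands in for the number of offsets of the next column. For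
    [om := transitions s] these are the continuations of [s]; linearity in [om] then splits them
    into the basic series. *)
Definition weighted (om : shape -> int) : pseries := fun n =>
  \sum_(m <- iota 1 n) \sum_(t <- shapes m) om t * (completions (n - m) t)%:Z.

Lemma eq_weighted om om' : (forall t, valid_shape 2 t -> om t = om' t) ->
  weighted om = weighted om'.
Proof.
move=> E; apply: funext => n; apply: eq_big_seq => m; rewrite mem_iota => Hm.
apply: eq_big_seq => t; rewrite mem_shapes; last by lia.
by case/andP=> /E->.
Qed.

Lemma weightedD om om' n :
  weighted (fun t => om t + om' t) n = weighted om n + weighted om' n.
Proof.
rewrite /weighted -big_split; apply: eq_bigr => m _; rewrite -big_split.
by apply: eq_bigr => t _; rewrite mulrDl.
Qed.

Lemma weightedZ a om n : weighted (fun t => a * om t) n = a * weighted om n.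
Proof.
rewrite /weighted mulr_sumr; apply: eq_bigr => m _; rewrite mulr_sumr.
by apply: eq_bigr => t _; rewrite mulrA.
Qed.

Lemma completions_weighted n s :
  (completions n s)%:Z = (1 : pseries) n + weighted (fun t =>
    (transitions s t)%:Z) n.
Proof.
case: n => [|n]; first by rewrite /weighted big_nil.
rewrite completionsS // add0r /weighted.
rewrite (big_morph (fun k : nat => k%:Z) PoszD (erefl _));
  apply: eq_bigr => m _.
by rewrite (big_morph (fun k : nat => k%:Z) PoszD (erefl _)); apply: eq_bigr.
Qed.

Definition low (t : shape) : nat := t.1.1.
Definition gap (t : shape) : nat := t.1.2.
Definition high (t : shape) : nat := t.2.

(* K, K', K1, P, Q are the continuations whose next column has, respectively,
   no gap, no gap (weighted by its length), a single cell, a gap of size one,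
     and
   a gap of size two; Ps and Qs count those of P and Q once for each run of
   length one of the next column. *)
Definition serK := weighted (fun t => (gap t == 0)%:R).
Definition serK' := weighted (fun t => (gap t == 0)%:R * (low t)%:R).
Definition serK1 := weighted (fun t => (gap t == 0)%:R * (low t == 1)%:R).
Definition serP := weighted (fun t => (gap t == 1)%:R).
Definition serQ := weighted (fun t => (gap t == 2)%:R).
Definition serPs :=
  weighted (fun t => (gap t == 1)%:R * ((low t == 1)%:R + (high t == 1)%:R)).
Definition serQlow := weighted (fun t => (gap t == 2)%:R * (low t == 1)%:R).
Definition serQhigh := weighted (fun t => (gap t == 2)%:R * (high t == 1)%:R).
Definition serQs := serQlow + serQhigh.

(** [serS] is the coefficient of the total length after every kind of column; [serR], [serV], [serW]
    are the constant terms after a column of gap 0, 1, 2. Their summand 1 is the empty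
    continuation. *)
Definition serS := serK + serP + serQ.
Definition serR : pseries := 1 + serK' - serP - (serQ + serQ).
Definition serV : pseries := 1 + serK + serK' - serQ.
Definition serW : pseries :=
  1 + (serK + serK) + serK' - serK1 + serP - serPs - serQs.

Lemma completions_single n a : (0 < a)%N ->
  (completions n (a, 0, 0)%N)%:Z = a%:R * serS n + serR n + (a == 1)%:R * serQ
    n.
Proof.
move=> a0; rewrite completions_weighted.
(* The indicator [a == 1] turns [a - 2] into the truncated difference: it adds 1 precisely when the
   integer would be -1. *)
rewrite (@eq_weighted _ (fun t =>
  (a%:R * (gap t == 0)%:R + (gap t == 0)%:R * (low t)%:R)
  + ((a%:R - 1) * (gap t == 1)%:R + (a%:R - 2 + (a == 1)%:R) * (gap t ==
    2)%:R))).
  by rewrite !weightedD !weightedZ /serS /serR !(pseries_addE, pseries_oppE);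
    ring.
move=> [[c h] d] /and3P[c0 h2 hd]; rewrite /gap /low /=.
case: h h2 hd => [|[|[|//]]] _ /= hd.
- have -> : d = 0%N by lia.
  by rewrite transitions_single_single //; lia.
- by rewrite transitions_single_double //; lia.
- by rewrite transitions_single_double //; lia.
Qed.

Lemma completions_gap1 n a b : (0 < a)%N -> (0 < b)%N ->
  (completions n (a, 1, b)%N)%:Z = (a + b)%:R * serS n + serV n.
Proof.
move=> a0 b0; rewrite completions_weighted.
rewrite (@eq_weighted _ (fun t =>
  ((a + b + 1)%:R * (gap t == 0)%:R + (gap t == 0)%:R * (low t)%:R)
  + ((a + b)%:R * (gap t == 1)%:R + ((a + b)%:R - 1) * (gap t == 2)%:R))).
  by rewrite !weightedD !weightedZ /serS /serV !(pseries_addE, pseries_oppE);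
    ring.
move=> [[c h] d] /and3P[c0 h2 hd]; rewrite /gap /low /=.
case: h h2 hd => [|[|[|//]]] _ /= hd.
- have -> : d = 0%N by lia.
  by rewrite transitions_gap1_single //; lia.
- by rewrite transitions_gap1_double //; lia.
- by rewrite transitions_gap1_double //; lia.
Qed.

Lemma completions_gap2 n a b : (0 < a)%N -> (0 < b)%N ->
  (completions n (a, 2, b)%N)%:Z = (a + b)%:R * serS n + serW n
    + (b == 1)%:R * serQlow n + (a == 1)%:R * serQhigh n.
Proof.
move=> a0 b0; rewrite completions_weighted.
(* For next gap 1 both forbidden offsets always occur. For next gap 2 they require [2 <= b] and
   [2 <= a], which gives the factors [(b == 1) - 1] and [(a == 1) - 1]. *)
rewrite (@eq_weighted _ (fun t =>
  ((a + b + 2)%:R * (gap t == 0)%:R + (gap t == 0)%:R * (low t)%:R)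
  + (-1) * ((gap t == 0)%:R * (low t == 1)%:R)
  + ((a + b + 1)%:R * (gap t == 1)%:R
     + (-1) * ((gap t == 1)%:R * ((low t == 1)%:R + (high t == 1)%:R)))
  + ((a + b)%:R * (gap t == 2)%:R
     + ((b == 1)%:R - 1) * ((gap t == 2)%:R * (low t == 1)%:R)
     + ((a == 1)%:R - 1) * ((gap t == 2)%:R * (high t == 1)%:R)))).
  rewrite !weightedD !weightedZ /serS /serW /serQs !(pseries_addE,
    pseries_oppE).
  by ring.
move=> [[c h] d] /and3P[c0 h2 hd]; rewrite /gap /low /high /=.
case: h h2 hd => [|[|[|//]]] _ /= hd.
- have -> : d = 0%N by lia.
  by have := transitions_gap2_single a0 b0 c0; lia.
- have d0 : (0 < d)%N by lia.
  by have := transitions_gap2_double a0 b0 c0 d0 (isT : (0 < 1 <= 2)%N); lia.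
- have d0 : (0 < d)%N by lia.
  by have := transitions_gap2_double a0 b0 c0 d0 (isT : (0 < 2 <= 2)%N); lia.
Qed.

(** Turns a sum over the size of the next column into a product of series. The constant terms must
    vanish because a column is never empty. *)
Lemma weighted_conv om (A B C S R T : pseries) :
  A 0%N = 0 -> B 0%N = 0 -> C 0%N = 0 ->
  (forall m n, (0 < m)%N ->
     \sum_(t <- shapes m) om t * (completions n t)%:Z =
     A m * S n + B m * R n + C m * T n) ->
  weighted om = A * S + B * R + C * T.
Proof.
move=> A0 B0 C0 E; apply: funext => n.
rewrite !pseries_addE !pseries_mulE -!big_split big_ord_recl /= A0 B0 C0 !mul0r
  !add0r.
have iotaE : iota 1 n = index_iota 1 n.+1 by rewrite /index_iota subSS subn0.
rewrite /weighted iotaE big_add1 big_mkord.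
by apply: eq_bigr => m _; rewrite E.
Qed.

Lemma sum_iota_ends (p : nat) (al be ga : int) :
  \sum_(c <- iota 1 p) (al + (c == 1)%:R * be + (p.+1 - c == 1)%N%:R * ga) =
  p%:R * al + (0 < p)%N%:R * (be + ga).
Proof.
rewrite !big_split /= big_const_seq count_predT size_iota iter_addr_0 -addrA.
congr (_ + _); first by rewrite mulr_natl.
rewrite mulrDr; congr (_ + _).
  case: p => [|p]; first by rewrite big_nil mul0r.
  rewrite /= big_cons big1_seq ?addr0 // => c /andP[_]; rewrite mem_iota => Hc.
  by rewrite (_ : (c == 1)%N = false) ?mul0r //; lia.
case: p => [|p]; first by rewrite big_nil mul0r.
have -> : iota 1 p.+1 = iota 1 (p + 1) by rewrite addn1.
rewrite iotaD big_cat /= big_cons big_nil addr0.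
rewrite big1_seq ?add0r => [|c /andP[_]].
  by congr (_%:R * _); lia.
rewrite mem_iota => Hc.
by rewrite (_ : (p.+2 - c == 1)%N = false) ?mul0r //; lia.
Qed.

(** [serx], [sery], [serz] are q/(1-q), q/(1-q)^2 and q(1+q)/(1-q)^3. *)
Definition serx : pseries := fun n => (0 < n)%N%:R.
Definition sery : pseries := fun n => n%:R.
Definition serz : pseries := fun n => n%:R ^+ 2.

Lemma sum_shapes (om : shape -> int) m n : (0 < m)%N ->
  \sum_(t <- shapes m) om t * (completions n t)%:Z =
  om (m, 0, 0)%N * (completions n (m, 0, 0)%N)%:Z
  + (\sum_(c <- iota 1 m.-1) om (c, 1, m - c)%N * (completions n (c, 1, m -
    c)%N)%:Z
  + \sum_(c <- iota 1 m.-1) om (c, 2, m - c)%N * (completions n (c, 2, m -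
    c)%N)%:Z).
Proof. by rewrite big_cons big_cat !big_map. Qed.

Lemma weighted_gap0 om : (forall c d, om (c, 1, d)%N = 0) ->
  (forall c d, om (c, 2, d)%N = 0) ->
  weighted om = ((fun m => om (m, 0, 0)%N * sery m) : pseries) * serS
    + ((fun m => om (m, 0, 0)%N * serx m) : pseries) * serR
    + ((fun m => om (m, 0, 0)%N * qvar m) : pseries) * serQ.
Proof.
move=> om1 om2; apply: weighted_conv => [|||m n m0]; try exact: mulr0.
rewrite sum_shapes // !big1 => [|c _|c _]; rewrite ?om1 ?om2 ?mul0r //.
by rewrite completions_single // /serx m0 /sery /qvar !addr0 !mulrDr !mulrA
  mulr1.
Qed.

Lemma serK_eq : serK = sery * serS + serx * serR + qvar * serQ.
Proof.
rewrite {1}/serK weighted_gap0 //.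
by congr (_ * _ + _ * _ + _ * _); apply: funext => m; rewrite mul1r.
Qed.

Lemma serK'_eq : serK' = serz * serS + sery * serR + qvar * serQ.
Proof.
rewrite {1}/serK' weighted_gap0; [|by move=> c d; rewrite mul0r ..].
congr (_ * _ + _ * _ + _ * _); apply: funext => m;
  rewrite /gap /low /= mul1r //.
- by case: m => // m; rewrite mulr1.
- by rewrite /qvar; case: eqP => [->|_]; rewrite ?mulr0 ?mulr1.
Qed.

Lemma serK1_eq : serK1 = qvar * (serS + serR + serQ).
Proof.
rewrite {1}/serK1 weighted_gap0; [|by move=> c d; rewrite mul0r ..].
rewrite (mulrDr _ (serS + serR)) (mulrDr _ serS);
  congr (_ * _ + _ * _ + _ * _); apply: funext => m;
  rewrite /gap /low /= mul1r /sery /serx /qvar;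
  by case: eqP => [E|_]; rewrite ?E ?mul0r ?mulr1.
Qed.

(** A column of size m with gap one splits in m - 1 ways, all with the same continuations since only
    [a + b = m] matters; the coefficients are m(m - 1) and m - 1. *)
Lemma serP_eq : serP = (serz - sery) * serS + (sery - serx) * serV.
Proof.
rewrite {1}/serP -[RHS]addr0 -(mul0r 0).
apply: weighted_conv => [|||[//|p] n _] //.
rewrite sum_shapes // mul0r add0r [X in _ + X]big1 => [|c _];
  last by rewrite mul0r.
under eq_big_seq => c.
  rewrite mem_iota => Hc; rewrite /gap /= mul1r completions_gap1; try by lia.
  rewrite (_ : (c + (p.+1 - c) = p.+1)%N); last by lia.
  over.
rewrite !pseries_addE !pseries_oppE /serz /sery /serx /= mulr0 !addr0.
by rewrite big_const_seq count_predT size_iota iter_addr_0 -mulr_natl; ring.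
Qed.

(** To the m - 1 splittings are added the corrections at the two ends: [serQhigh] from the lower run
    of length one, [serQlow] from the upper. Both ends exist once m is at least 2, so only [serQs]
    appears, with coefficient [serx - qvar]. *)
Lemma serQ_eq : serQ = (serz - sery) * serS + (sery - serx) * serW
  + (serx - qvar) * serQs.
Proof.
rewrite {1}/serQ; apply: weighted_conv => [|||[//|p] n _] //.
rewrite sum_shapes // mul0r add0r [X in X + _]big1 => [|c _];
  last by rewrite mul0r.
rewrite add0r (eq_big_seq (fun c => (p.+1%:R * serS n + serW n)
  + (c == 1)%:R * serQhigh n + (p.+1 - c == 1)%N%:R * serQlow n)) => [|c];
    last first.
  rewrite mem_iota /= => Hc;
    have [c0 d0] : (0 < c)%N /\ (0 < p.+1 - c)%N by lia.
  rewrite /gap /= mul1r completions_gap2 //.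
  have -> : (c + (p.+1 - c) = p.+1)%N by lia.
  exact: addrAC.
rewrite sum_iota_ends -[(serz - sery) _]/(p.+1%:R ^+ 2 - p.+1%:R)
  -[(sery - serx) _]/(p.+1%:R - 1) -[(serx - qvar) _]/(1 - (p.+1 == 1)%:R)
  -[serQs n]/(serQlow n + serQhigh n).
move: (serS n) (serW n) (serQhigh n) (serQlow n) => s w a b.
by case: p => [|p] /=; ring.
Qed.

Lemma serPs_eq : serPs = (sery - qvar + (sery - qvar)) * serS
  + (serx - qvar + (serx - qvar)) * serV.
Proof.
rewrite {1}/serPs -[RHS]addr0 -(mul0r 0).
apply: weighted_conv => [|||[//|p] n _] //.
rewrite sum_shapes // !mul0r add0r [X in _ + X]big1 => [|c _];
  last by rewrite !mul0r.
rewrite addr0 (eq_big_seq (fun c =>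
  0 + (c == 1)%:R * (p.+1%:R * serS n + serV n)
   + (p.+1 - c == 1)%N%:R * (p.+1%:R * serS n + serV n))) => [|c]; last first.
  rewrite mem_iota /= => Hc;
    have [c0 d0] : (0 < c)%N /\ (0 < p.+1 - c)%N by lia.
  rewrite /gap /low /high /= mul1r completions_gap1 //.
  have -> : (c + (p.+1 - c) = p.+1)%N by lia.
  by rewrite add0r mulrDl.
rewrite sum_iota_ends -[(sery - qvar + _) _]/(p.+1%:R - (p.+1 == 1)%:R +
  (p.+1%:R - (p.+1 == 1)%:R))
  -[(serx - qvar + _) _]/(1 - (p.+1 == 1)%:R + (1 - (p.+1 == 1)%:R)).
move: (serS n) (serV n) => s v.
by case: p => [|p] /=; ring.
Qed.

(** The shape [(1, 2, 1)] has both runs of length one: it is counted twice and carries both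
    corrections each time. This second copy of [serQs] at m = 2 is the term [qvar ^+ 2]. *)
Lemma serQs_eq : serQs = (sery - qvar + (sery - qvar)) * serS
  + (serx - qvar + (serx - qvar)) * serW + (serx - qvar + qvar ^+ 2) * serQs.
Proof.
have E : serQs =
    weighted (fun t => (gap t == 2)%:R * ((low t == 1)%:R + (high t == 1)%:R)).
  apply: funext => n; rewrite -[LHS]/(serQlow n + serQhigh n) -weightedD.
  by congr (weighted _ n); apply: funext => t; rewrite mulrDr.
have q2 m : (qvar ^+ 2) m = (m == 2)%:R by rewrite expr2 qvar_mulE; case: m.
rewrite {1}E; apply: weighted_conv => [|||[//|p] n _] //.
  by rewrite -[LHS]/(serx 0%N - qvar 0%N + (qvar ^+ 2) 0%N) q2.
rewrite sum_shapes // !mul0r add0r [X in X + _]big1 => [|c _];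
  last by rewrite !mul0r.
rewrite add0r (eq_big_seq (fun c => 0
   + (c == 1)%:R * (p.+1%:R * serS n + serW n + serQhigh n + (p == 1)%:R *
     serQlow n)
   + (p.+1 - c == 1)%N%:R *
     (p.+1%:R * serS n + serW n + serQlow n + (p == 1)%:R * serQhigh n))) =>
       [|c]; last first.
  rewrite mem_iota /= => Hc;
    have [c0 d0] : (0 < c)%N /\ (0 < p.+1 - c)%N by lia.
  rewrite /gap /low /high /= mul1r completions_gap2 //.
  have -> : (c + (p.+1 - c) = p.+1)%N by lia.
  move: (serS n) (serW n) (serQhigh n) (serQlow n) => s w a b.
  have [c1|c1] := eqVneq c 1%N.
    by rewrite c1 subn1 /=; case: (p == 1)%N => /=; ring.
  have [d1|d1] := eqVneq (p.+1 - c)%N 1%N; last by rewrite /=; ring.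
  have -> : (p == 1)%N = false by lia.
  by rewrite /=; ring.
rewrite sum_iota_ends
  -[(sery - qvar + _) _]/(p.+1%:R - (p.+1 == 1)%:R + (p.+1%:R - (p.+1 == 1)%:R))
  -[(serx - qvar + (serx - qvar)) _]/(1 - (p.+1 == 1)%:R + (1 - (p.+1 == 1)%:R))
  -[(serx - qvar + qvar ^+ 2) _]/(1 - (p.+1 == 1)%:R + (qvar ^+ 2) p.+1) q2
  -[serQs n]/(serQlow n + serQhigh n).
move: (serS n) (serW n) (serQhigh n) (serQlow n) => s w a b.
by case: p => [|p] /=; ring.
Qed.

Lemma serx_eq : (1 - qvar) * serx = qvar.
Proof.
apply: funext => n; rewrite mulrBl mul1r pseries_addE pseries_oppE qvar_mulE.
by case: n => [|[|n]].
Qed.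

Lemma sery_eq : (1 - qvar) * sery = serx.
Proof.
apply: funext => n; rewrite mulrBl mul1r pseries_addE pseries_oppE qvar_mulE.
by case: n => [|n] //; rewrite /sery /serx /=; lia.
Qed.

Lemma serz_eq : (1 - qvar) * serz = sery + sery - serx.
Proof.
apply: funext => n.
rewrite mulrBl mul1r !pseries_addE !pseries_oppE qvar_mulE.
by case: n => [|n] //; rewrite /sery /serx /serz /= -addn1 natrD; ring.
Qed.

(** Each equation is multiplied by the power of [u] that clears the denominators of [x], [y], [z],
    which gives the hypotheses of the elimination over polynomials in [q]. *)
Lemma series_system_eliminated (A : comNzRingType) (q x y z K K' K1 P Q Ps Qs :
  A) :
  let u := 1 - q in
  let S := K + P + Q in let R := 1 + K' - P - (Q + Q) in
  let V := 1 + K + K' - Q in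
  let W := 1 + (K + K) + K' - K1 + P - Ps - Qs in
  u * x = q -> u * y = x -> u * z = y + y - x ->
  K = y * S + x * R + q * Q ->
  K' = z * S + y * R + q * Q ->
  K1 = q * (S + R + Q) ->
  P = (z - y) * S + (y - x) * V ->
  Q = (z - y) * S + (y - x) * W + (x - q) * Qs ->
  Ps = (y - q + (y - q)) * S + (x - q + (x - q)) * V ->
  Qs = (y - q + (y - q)) * S + (x - q + (x - q)) * W + (x - q + q ^+ 2) * Qs ->
  u * (u * (u * ((1 - 9 * q + 27 * q ^+ 2 - 31 * q ^+ 3 + 8 * q ^+ 4 + 4 * q ^+
    5
     - 2 * q ^+ 6 + 16 * q ^+ 7 - 5 * q ^+ 8 - 16 * q ^+ 9 - 2 * q ^+ 10
     + 5 * q ^+ 11) * K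
    - q * (1 - 6 * q + 11 * q ^+ 2 - 6 * q ^+ 3 - q ^+ 4 - 3 * q ^+ 6
     + 5 * q ^+ 7 + 4 * q ^+ 8 - 3 * q ^+ 9 - 3 * q ^+ 10)))) = 0.
Proof.
move=> u S R V W ex ey ez eK eK' eK1 eP eQ ePs eQs.
have ey2 : u ^+ 2 * y = q by rewrite expr2 -mulrA ey ex.
have ez3 : u ^+ 3 * z = q * (1 + q).
  have -> : u ^+ 3 * z = u ^+ 2 * (u * z) by ring.
  rewrite ez (_ : _ * _ = 2 * (u ^+ 2 * y) - u * (u * x)); last by ring.
  by rewrite ey2 ex /u; ring.
apply: (@linear_system_elimination _ _ _ K' K1 P Q Ps Qs).
- transitivity (u ^+ 2 * y * S + u * (u * x) * R + u ^+ 2 * q * Q).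
    by rewrite -/u {1}eK; ring.
  by rewrite ey2 ex /S /R /u; ring.
- transitivity (u ^+ 3 * z * S + u * (u ^+ 2 * y) * R + u ^+ 3 * q * Q).
    by rewrite -/u {1}eK'; ring.
  by rewrite ey2 ez3 /S /R /u; ring.
- by rewrite {1}eK1 /S /R; ring.
- transitivity ((u ^+ 3 * z - u * (u ^+ 2 * y)) * S
     + u * (u ^+ 2 * y - u * (u * x)) * V).
    by rewrite -/u {1}eP; ring.
  by rewrite ey2 ez3 ex /S /V /u; ring.
- transitivity ((u ^+ 3 * z - u * (u ^+ 2 * y)) * S
     + u * (u ^+ 2 * y - u * (u * x)) * W + u ^+ 2 * (u * x - u * q) * Qs).
    by rewrite -/u {1}eQ; ring.
  by rewrite ey2 ez3 ex /S /W /u; ring.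
- transitivity (2 * (u ^+ 2 * y - u ^+ 2 * q) * S
     + 2 * (u * (u * x) - u ^+ 2 * q) * V).
    by rewrite -/u {1}ePs; ring.
  by rewrite ey2 ex /S /V /u; ring.
transitivity (2 * (u ^+ 2 * y - u ^+ 2 * q) * S
   + 2 * (u * (u * x) - u ^+ 2 * q) * W
   + (u * (u * x) - u ^+ 2 * q + u ^+ 2 * q ^+ 2) * Qs).
  by rewrite -/u {1}eQs; ring.
by rewrite ey2 ex /S /W /u; ring.
Qed.

(** The first column has no gap and its height is fixed by anchoring, so it enters with weight one,
    exactly like the next column in [serK]. *)
Lemma cheesy_gf_serK : cheesy_gf 2 = serK.
Proof.
apply: funext => n; rewrite cheesy_gfE; apply: eq_bigr => m _.
by rewrite big_cons big_cat !big_map !big1 // mul1r !addr0.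
Qed.

(* The equation K_den * K = K_num in Z[[q]] is K = K_num / K_den, as K_den has
   constant term 1 and is therefore a unit.
     *)
Theorem proposition3 :
  (forall n : nat, finite_set (cheesy_classes 2 n)) /\
  fps_mul (fps_of_poly K_den) (cheesy_gf 2) = fps_of_poly K_num.
Proof.
split; first exact: finite_cheesy_classes.
rewrite cheesy_gf_serK.
have := series_system_eliminated serx_eq sery_eq serz_eq serK_eq serK'_eq
  serK1_eq serP_eq serQ_eq serPs_eq serQs_eq.
(* The three factors [1 - qvar] left over from the determinant are cancelled here. *)
do 3!move/onesubq_mulI; rewrite -pseries_of_polyX => /subr0_eq E.
change (pseries_of_poly K_den * serK = pseries_of_poly K_num)%R.
rewrite (rmorph_K_den pseries_of_poly) (rmorph_K_num pseries_of_poly).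
exact: E.
Qed.
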